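(* Let $K$ be a field and let $H$ be a numerical semigroup. Then there exists $k_0\in\mathbb{N}$ such that for all $k\ge k_0$ the ideal $I_{H_k}$ is minimally generated by a standard basis and such that $\beta_i(I_{H_k})=\beta_i(I_{H_k}^* )$ for all $i$. In particular, $\operatorname{gr}_{\mathfrak m}K[H_k]$ is Cohen–Macaulay for all $k\ge k_0$.
   Context: A numerical semigroup is a subsemigroup $H\subset\mathbb{N}$ with $0\in H$ (the gcd of its elements is not required to be $1$); it has a unique minimal system of generators $a_1<\dots<a_r$ (positive integers), and we write $H=\langle a_1,\dots,a_r\rangle$. For an integer $k\ge 0$ put $H_k=\langle a_1+k,\dots,a_r+k\rangle$. For a numerical semigroup $L$ with minimal generators $b_1<\dots<b_s$, $K[L]\subset K[t]$ is the $K$-subalgebra generated by $t^{b_1},\dots,t^{b_s}$; with $S=K[x_1,\dots,x_s]$, $I_L\subset S$ is the kernel of the $K$-algebra map $S\to K[t]$, $x_i\mapsto t^{b_i}$. The ring $\operatorname{gr}_{\mathfrak m}K[L]$ (the coordinate ring of the tangent cone) is the associated graded ring of $K[L]$ with respect to $\mathfrak m=(t^{b_1},\dots,t^{b_s})$. For a nonzero polynomial $f$, $f^*$ is its nonzero homogeneous component of least degree (standard grading). For an ideal $I\subset S$, $I^*=(f^*: f\in I, f\ne 0)$; elements $f_1,\dots,f_m\in I$ form a standard basis of $I$ if $I^*=(f_1^*,\dots,f_m^* )$. One has $\operatorname{gr}_{\mathfrak m}K[L]\cong S/I_L^*$. Betti numbers are $\beta_i(M)=\dim_K\operatorname{Tor}_i^S(M,K)$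 with $K=S/(x_1,\dots,x_s)$ ($I_L$ is graded for $\deg x_i=b_i$, and $I_L^*$ for the standard grading). *)

(* Defs.v *)
From HB Require Import structures.
From mathcomp Require Import all_boot all_order all_algebra.
From mathcomp Require Import boolp.
From mathcomp Require Import mpoly.

Set Implicit Arguments.
Unset Strict Implicit.
Unset Printing Implicit Defensive.

Import GRing.Theory.
Local Open Scope ring_scope.

(** * Numerical semigroups *)

(* No gcd condition is imposed, and {0} is allowed. *)
Record numSemigroup := NumSemigroup {
  sg_pred :> pred nat;
  sg0 : sg_pred 0%N;
  sgD : forall x y, sg_pred x -> sg_pred y -> sg_pred (x + y)%N }.

Definition spanned (b : seq nat) : pred nat :=
  fun x => `[< exists c : nat -> nat,
                 x = (\sum_(i < size b) c i * nth 0 b i)%N >].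

Lemma spanned0 b : spanned b 0%N.
Proof. by apply/asboolP; exists (fun=> 0%N); rewrite big1. Qed.

Lemma spannedD b x y : spanned b x -> spanned b y -> spanned b (x + y)%N.
Proof.
move=> /asboolP[c ->] /asboolP[d ->]; apply/asboolP.
exists (fun i => c i + d i)%N; rewrite -big_split /=.
by apply: eq_bigr => i _; rewrite mulnDl.
Qed.

(* <b_1, ..., b_s> *)
Definition span_sg (b : seq nat) : numSemigroup :=
  NumSemigroup (spanned0 b) (@spannedD b).

(* Subsequences of a strictly increasing sequence are exactly the subsets of
   its set of entries. *)
Definition is_mingens (H : numSemigroup) (b : seq nat) : Prop :=
  [/\ sorted ltn b, all (fun x => 0 < x)%N b, H =1 span_sg b
    & forall b', subseq b' b -> H =1 span_sg b' -> b' = b].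

Lemma spanned_mem b x : x \in b -> spanned b x.
Proof.
move=> xb; apply/asboolP; exists (fun i => (i == index x b)%N : nat).
have lt_xb : (index x b < size b)%N by rewrite index_mem.
rewrite (bigD1 (Ordinal lt_xb)) //= eqxx mul1n nth_index // big1 ?addn0 //.
by move=> i; rewrite -val_eqE /= => /negbTE->.
Qed.

Lemma sgM (H : numSemigroup) c x : H x -> H (c * x)%N.
Proof.
by move=> Hx; elim: c => [|c IHc]; rewrite ?mul0n ?sg0 // mulSn; apply: sgD.
Qed.

Lemma spanned_sub (H : numSemigroup) b :
  {subset b <= [pred x | H x]} -> forall x, spanned b x -> H x.
Proof.
move=> sbH x /asboolP[c ->]; elim/big_ind: _ => [|u v|i _]; first exact: sg0.
  exact: sgD.
by apply: sgM; apply: (sbH); apply: mem_nth.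
Qed.

Lemma sg_fingen (H : numSemigroup) :
  exists b, [/\ sorted ltn b, all (fun x => 0 < x)%N b & H =1 span_sg b].
Proof.
have [[m0 Hm0]|noH] := pselect (exists m, (0 < m)%N && H m); last first.
  exists [::]; split=> // x /=; apply/idP/idP => [Hx|].
    case: x Hx => [|x] Hx; first exact: spanned0.
    by case: noH; exists x.+1.
  exact: spanned_sub.
have [m_gt0 Hm] := andP Hm0.
have [w Hw] : exists w : nat -> nat,
    forall x, H x -> [/\ H (w (x %% m0)), w (x %% m0) <= x
                       & w (x %% m0) = x %[mod m0]]%N.
  have ex r : exists w, forall x, H x -> (x %% m0 = r)%N ->
      [/\ H w, w <= x & w = x %[mod m0]]%N.
    have [[y Hy]|no] := pselect (exists y, H y && (y %% m0 == r)%N).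
      case: (ex_minnP (ex_intro (fun y => H y && (y %% m0 == r)%N) y Hy)).
      move=> w /andP[Hw /eqP wr] minw; exists w => x Hx xr.
      by split=> //; [apply: minw; rewrite Hx xr eqxx | rewrite wr xr].
    by exists 0%N => x Hx xr; case: no; exists x; rewrite Hx xr eqxx.
  by have [w Pw] := choice ex; exists w => x Hx; apply: Pw.
pose N := (m0 + \sum_(r < m0) w r)%N.
pose b := [seq x <- iota 1 N | H x].
have bP x : (x \in b) = [&& H x, 0 < x & x <= N]%N.
  by rewrite mem_filter mem_iota add1n ltnS.
exists b; split.
- by apply: sorted_filter (iota_ltn_sorted _ _) => ? ? ?; apply: ltn_trans.
- by apply/allP => x; rewrite bP => /and3P[].
move=> x; apply/idP/idP; last first.
  by apply: spanned_sub => y; rewrite bP => /and3P[].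
move=> Hx; have [Hwx le_wx /eqP eq_w] := Hw x Hx.
have /dvdnP[c xE] : (m0 %| x - w (x %% m0))%N by rewrite -eqn_mod_dvd // eq_sym.
rewrite -(subnKC le_wx) xE; apply: (@sgD (span_sg b)).
  have [->|w_gt0] := posnP (w (x %% m0)%N); first exact: sg0.
  apply: spanned_mem; rewrite bP Hwx w_gt0 /N /=.
  rewrite (bigD1 (Ordinal (ltn_pmod x m_gt0))) //=.
  by rewrite addnCA leq_addr.
by apply: sgM; apply: spanned_mem; rewrite bP Hm m_gt0 leq_addr.
Qed.

Lemma mingens_exists (H : numSemigroup) : exists b, is_mingens H b.
Proof.
have [b0] := sg_fingen H; move: {2}(size b0) (leqnn (size b0)) => n.
elim: n b0 => [|n IHn] b0 le_b0 [sb pb Hb].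
  move: le_b0; rewrite leqn0 size_eq0 => /eqP b00.
  by exists b0; split=> // b'; rewrite b00 subseq0 => /eqP.
have [[b' [sub Hb' ne]]|no] :=
    pselect (exists b', [/\ subseq b' b0, H =1 span_sg b' & b' <> b0]).
  apply: (IHn b').
    have := size_subseq sub; rewrite leq_eqVlt => /orP[/eqP eq_s|lt_s].
      by case: ne; apply/eqP; rewrite -(size_subseq_leqif sub) eq_s.
    by rewrite -ltnS (leq_trans lt_s).
  split=> //; first by apply: subseq_sorted sb => // ? ? ?; apply: ltn_trans.
  by apply/allP => x /(mem_subseq sub); apply/allP.
by exists b0; split=> // b' sub Hb'; apply/not_notP => ne; case: no; exists b'.
Qed.

Definition mingens (H : numSemigroup) : seq nat := sval (cid (mingens_exists H)).

Lemma mingensP (H : numSemigroup) : is_mingens H (mingens H).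
Proof. exact: svalP (cid (mingens_exists H)). Qed.

Definition shift_sg (H : numSemigroup) (k : nat) : numSemigroup :=
  span_sg [seq (a + k)%N | a <- mingens H].

(** * Ideals of commutative rings *)

Section Ideals.
Variable A : comNzRingType.
Implicit Types (X J P : A -> Prop).

Definition is_ideal J : Prop :=
  [/\ J 0, forall a b, J a -> J b -> J (a + b) & forall a b, J b -> J (a * b)].

Definition ideal_gen X : A -> Prop := fun f =>
  exists2 s : seq (A * A), (forall u, u \in s -> X u.2)
                         & f = \sum_(u <- s) u.1 * u.2.

Lemma ideal_gen_is_ideal X : is_ideal (ideal_gen X).
Proof.
split; first by exists [::] => //; rewrite big_nil.
- move=> _ _ [s Xs ->] [t Xt ->]; exists (s ++ t); last by rewrite big_cat.
  by move=> u; rewrite mem_cat => /orP[/Xs|/Xt].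
- move=> a _ [s Xs ->]; exists [seq (a * u.1, u.2) | u <- s].
    by move=> _ /mapP[u /Xs Xu ->].
  by rewrite big_map mulr_sumr; apply: eq_bigr => u _; rewrite mulrA.
Qed.

Lemma ideal_gen_mem X a : X a -> ideal_gen X a.
Proof.
move=> Xa; exists [:: (1, a)]; last by rewrite big_seq1 mul1r.
by move=> u; rewrite inE => /eqP->.
Qed.

Lemma ideal_gen_sub X J :
  is_ideal J -> (forall a, X a -> J a) -> forall a, ideal_gen X a -> J a.
Proof.
move=> [J0 JD JM] XJ _ [s Xs ->]; rewrite big_seq.
by elim/big_ind: _ => // u /Xs Xu; apply/JM/XJ.
Qed.

Fixpoint ideal_pow J (n : nat) : A -> Prop :=
  if n is n'.+1 then
    ideal_gen (fun c => exists a b, [/\ J a, ideal_pow J n' b & c = a * b])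
  else fun=> True.

Lemma ideal_pow_is_ideal J n : is_ideal (ideal_pow J n).
Proof. by case: n => [|n]; [split | apply: ideal_gen_is_ideal]. Qed.

Lemma ideal_powM J i j a b :
  ideal_pow J i a -> ideal_pow J j b -> ideal_pow J (i + j) (a * b).
Proof.
elim: i a => [|i IHi] a.
  by move=> _ Jb; have [_ _ JM] := ideal_pow_is_ideal J j; apply: JM.
move=> Ja Jb; have [J0 JD JM] := ideal_pow_is_ideal J (i.+1 + j).
pose I' a := ideal_pow J (i.+1 + j) (a * b).
apply: (@ideal_gen_sub _ I' _ _ a Ja); rewrite {}/I'.
- split=> [|x y|x y]; first by rewrite mul0r.
  + by rewrite mulrDl; apply: JD.
  + by rewrite -mulrA; apply: JM.
- move=> _ [x [y [Jx Jy ->]]]; apply: ideal_gen_mem.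
  by exists x, (y * b); split; rewrite ?mulrA //; apply: IHi.
Qed.

Definition prime_ideal P : Prop :=
  [/\ is_ideal P, ~ P 1 & forall a b, P (a * b) -> P a \/ P b].

Definition maximal_ideal P : Prop :=
  [/\ is_ideal P, ~ P 1
    & forall J, is_ideal J -> ~ J 1 -> (forall a, P a -> J a) ->
        forall a, J a -> P a].

Definition noetherian : Prop :=
  forall J, is_ideal J ->
    exists s : seq A, forall a, J a <-> ideal_gen (fun x => x \in s) a.

(** Dimension and depth of the localization [A_P] at a prime [P], expressed
    without building [A_P]: its primes are the primes of [A] inside [P]; the
    image of [a] lies in [J A_P] iff [s * a] is in [J] for some [s] not in [P];
    and, up to units of [A_P], the elements of its maximal ideal are the images
    of the elements of [P].  A sequence in [P] generates a proper ideal of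
    [A_P], so no further condition is needed for it to be regular. *)

Definition prime_chain P (d : nat) : Prop :=
  exists p : nat -> A -> Prop,
    [/\ forall i, (i <= d)%N -> prime_ideal (p i),
        forall i, (i < d)%N -> (forall a, p i a -> p i.+1 a)
                            /\ (exists2 a, p i.+1 a & ~ p i a)
      & forall a, p d a -> P a].

Definition loc_dim P (d : nat) : Prop :=
  prime_chain P d /\ forall e, prime_chain P e -> (e <= d)%N.

Definition in_loc_ideal P J (a : A) : Prop := exists2 s, ~ P s & J (s * a).

Definition loc_regular P (xs : seq A) : Prop :=
  (forall x, x \in xs -> P x) /\
  forall i, (i < size xs)%N ->
    let J := ideal_gen (fun x => x \in take i xs) in
    forall a, in_loc_ideal P J (xs`_i * a) -> in_loc_ideal P J a.

Definition loc_depth P (d : nat) : Prop :=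
  (exists2 xs, loc_regular P xs & size xs = d) /\
  forall xs, loc_regular P xs -> (size xs <= d)%N.

Definition cohen_macaulay : Prop :=
  noetherian /\
  forall P, maximal_ideal P -> exists2 d, loc_dim P d & loc_depth P d.

End Ideals.

(** * The associated graded ring *)

Record properIdeal (A : comNzRingType) := ProperIdeal {
  pi_pred :> A -> Prop;
  pi_ideal : is_ideal pi_pred;
  pi_proper : ~ pi_pred 1 }.

(** [gr_m R], the direct sum of the [m^i / m^(i+1)], is realized as the quotient
    of the ring of polynomials [p] over [R] with [p`_i] in [m^i] (the Rees
    algebra) by the ideal of those with [p`_i] in [m^(i+1)]. *)

Section AssociatedGraded.
Variables (R : comNzRingType) (m : properIdeal R).

Definition rees_pred : pred {poly R} :=
  fun p => `[< forall i, ideal_pow m i p`_i >].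

Lemma rees_subring : subring_closed rees_pred.
Proof.
split.
- apply/asboolP => i; rewrite coefC; case: i => //= i.
  by have [] := ideal_pow_is_ideal m i.+1.
- move=> p q /asboolP pP /asboolP qP; apply/asboolP => i.
  have [_ JD JM] := ideal_pow_is_ideal m i.
  by rewrite coefB -mulN1r; apply: JD (pP i) (JM _ _ (qP i)).
- move=> p q /asboolP pP /asboolP qP; apply/asboolP => i; rewrite coefM.
  have [J0 JD JM] := ideal_pow_is_ideal m i.
  elim/big_ind: _ => // j _.
  by have := ideal_powM (pP j) (qP (i - j)%N); rewrite subnKC // -ltnS.
Qed.

HB.instance Definition _ := GRing.isSubringClosed.Build _ rees_pred rees_subring.

Record rees := Rees { rees_val :> {poly R}; rees_valP : rees_val \in rees_pred }.

HB.instance Definition _ := [isSub for rees_val].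
HB.instance Definition _ := [Choice of rees by <:].
HB.instance Definition _ := [SubChoice_isSubComNzRing of rees by <:].

Definition rees_ideal : pred rees :=
  fun p => `[< forall i, ideal_pow m i.+1 (rees_val p)`_i >].

Lemma rees_ideal_closed : idealr_closed rees_ideal.
Proof.
split.
- apply/asboolP => i; rewrite coef0.
  by have [] := ideal_pow_is_ideal m i.+1.
- apply/negP => /asboolP/(_ 0%N); rewrite coefC /= => m1.
  apply: (pi_proper (p := m)); have [_ _ mM] := pi_ideal m.
  apply: (ideal_gen_sub (pi_ideal m) _ m1) => _ [a [b [ma _ ->]]].
  by rewrite mulrC; apply: mM.
- move=> a u v /asboolP uP /asboolP vP; apply/asboolP => i.
  have [J0 JD JM] := ideal_pow_is_ideal m i.+1.
  rewrite coefD; apply: (JD _ _ _ (vP i)); rewrite coefM.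
  apply: (big_ind (ideal_pow m i.+1)) => // j _.
  have /asboolP/(_ j) aj := rees_valP a.
  by have := ideal_powM aj (uP (i - j)%N); rewrite addnS subnKC // -ltnS.
Qed.

HB.instance Definition _ := isIdealr.Build rees rees_ideal rees_ideal_closed.

Definition assoc_graded : comNzRingType :=
  {ideal_quot (rees_ideal : idealr rees)}.

End AssociatedGraded.

(** * Toric ideals, semigroup rings, tangent cones *)

Section Toric.
Variables (K : fieldType) (L : numSemigroup).
Local Notation b := (mingens L).
Local Notation S := {mpoly K[size b]}.

Definition toric_map : S -> {poly K} :=
  mmap (@polyC K) (fun i : 'I_(size b) => 'X^(nth 0%N b i)).

Definition toric_ideal : S -> Prop := fun f => toric_map f = 0.

(* The subalgebra of K[t] generated by the t^(b_i) is the image of toric_map. *)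
Definition sgring_pred : pred {poly K} :=
  fun p => `[< exists f : S, p = toric_map f >].

Lemma sgring_subring : subring_closed sgring_pred.
Proof.
split.
- by apply/asboolP; exists 1; rewrite /toric_map rmorph1.
- move=> _ _ /asboolP[f ->] /asboolP[g ->]; apply/asboolP.
  by exists (f - g); rewrite /toric_map rmorphB.
- move=> _ _ /asboolP[f ->] /asboolP[g ->]; apply/asboolP.
  by exists (f * g); rewrite /toric_map rmorphM.
Qed.

HB.instance Definition _ :=
  GRing.isSubringClosed.Build _ sgring_pred sgring_subring.

Record sgring := SgRing {
  sgring_val :> {poly K}; sgring_valP : sgring_val \in sgring_pred }.

HB.instance Definition _ := [isSub for sgring_val].
HB.instance Definition _ := [Choice of sgring by <:].
HB.instance Definition _ := [SubChoice_isSubComNzRing of sgring by <:].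

Definition sgring_max_pred : sgring -> Prop :=
  ideal_gen (fun x => exists2 c, c \in b & sgring_val x = 'X^c).

Lemma sgring_max_proper : ~ sgring_max_pred 1.
Proof.
pose J (x : sgring) := (sgring_val x)`_0 = 0.
have idJ : is_ideal J.
  split=> [|x y|x y]; rewrite /J /= ?coef0 ?coefD ?coefM //.
    by move=> -> ->; rewrite addr0.
  by rewrite big_ord1 => ->; rewrite mulr0.
move=> /(ideal_gen_sub idJ) J1; have : J 1.
  apply: J1 => x [c cb xE]; rewrite /J xE coefXn.
  have [_ /allP/(_ c cb) c_gt0 _ _] := mingensP L.
  by rewrite eq_sym gtn_eqF.
by rewrite /J /= coef1 /= => /eqP; rewrite oner_eq0.
Qed.

Definition sgring_max : properIdeal sgring :=
  ProperIdeal (ideal_gen_is_ideal _) sgring_max_proper.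

(* gr_m K[L] *)
Definition tangent_cone : comNzRingType := assoc_graded sgring_max.

End Toric.

Section PolynomialIdeals.
Variables (K : fieldType) (n : nat).
Local Notation S := {mpoly K[n]}.
Implicit Types (I : S -> Prop) (f : S) (fs : seq S).

(* Least degree of a monomial of f, for f != 0; msize f exceeds all of them. *)
Definition mindeg f : nat := (\big[minn/msize f]_(m <- msupp f) mdeg m)%N.

(* f^* *)
Definition initform f : S := pihomog mdeg (mindeg f) f.

(* I^* *)
Definition initideal I : S -> Prop :=
  ideal_gen (fun g => exists f, [/\ I f, f != 0 & g = initform f]).

(* f^* is defined for nonzero f only, whence the last condition. *)
Definition standard_basis I fs : Prop :=
  [/\ forall f, f \in fs -> I f, 0 \notin fs
    & forall g, initideal I g <->
        ideal_gen (fun h => h \in [seq initform f | f <- fs]) g].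

Definition generates I fs : Prop :=
  forall g, I g <-> ideal_gen (fun h => h \in fs) g.

Definition minimally_generates I fs : Prop :=
  generates I fs /\ forall gs, generates I gs -> (size fs <= size gs)%N.

(** Resolutions ... -> S^(r_1) -> S^(r_0) -> I -> 0 by free modules of finite
    rank, with elements of the free modules written as row vectors on which the
    matrices act from the right. *)

Definition exact_at (p q r : nat) (B : 'M[S]_(p, q)) (C : 'M[S]_(q, r)) : Prop :=
  forall v : 'rV[S]_q, v *m C = 0 <-> exists u : 'rV[S]_p, v = u *m B.

Record free_resolution I := FreeResolution {
  fr_rank : nat -> nat;
  fr_aug : 'cV[S]_(fr_rank 0);
  fr_diff : forall i, 'M[S]_(fr_rank i.+1, fr_rank i);
  fr_aug_im : forall f, I f <-> exists u : 'rV[S]_(fr_rank 0), u *m fr_aug = f%:M;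
  fr_exact0 : exact_at (fr_diff 0) fr_aug;
  fr_exactS : forall i, exact_at (fr_diff i.+1) (fr_diff i) }.

(* Differentials of F \otimes_S K, where K = S/(x_1, ..., x_n). *)
Definition fr_diffK I (F : free_resolution I) (i : nat) :
    'M[K]_(fr_rank F i.+1, fr_rank F i) :=
  map_mx (mcoeff 0%MM) (fr_diff F i).

(* dim_K H_i(F \otimes_S K) *)
Definition tor_dim I (F : free_resolution I) (i : nat) : nat :=
  if i is j.+1 then (\rank (kermx (fr_diffK F j)) - \rank (fr_diffK F i))%N
  else (fr_rank F 0 - \rank (fr_diffK F 0))%N.

(* [betti I i c] says that beta_i(I) = c: Tor is computed by any resolution. *)
Definition betti I (i c : nat) : Prop :=
  exists F : free_resolution I, tor_dim F i = c.

End PolynomialIdeals.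

(* Main.v *)
(** Let [b_0 < ... < b_r] be the minimal generators of [L = H_k] and
    [e = b_r - b_0], which is bounded independently of [k].  Once [b_0 >= e^2], a
    pigeonhole argument modulo [e] shows: if an element of [L] has factorizations
    of lengths [l' < l], then it has one of length [l] that involves [b_0].

    For each weight [h] fix a monomial [rep h] of weight [h], of maximal degree,
    and divisible by [x_0] whenever [h] has factorizations of several lengths.
    Then [I = I_L] is spanned by the binomials [m - rep (wt m)], and [I^*] by
    their initial forms, namely the same binomial if [deg m] is maximal and [m]
    otherwise.  So [I] and [I^*] coincide modulo [x_0], and [x_0] is a nonzerodivisor
    modulo both of them.

    Resolutions of [I] and [I^*] can therefore be built simultaneously with
    differentials that agree modulo [x_0], so they have the same Tor; and the
    initial forms of a minimal set of binomial generators of [I] generate [I^*] by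
    induction on the weight.  Finally, in [gr_m K[L] = S/I^*] every [x_i] with
    [i > 0] is nilpotent, since [x_i^(b_0)] and [x_0^(b_i)] have the same weight,
    while every nonzero [p(x_0)] is a nonzerodivisor: modulo nilpotents it is the
    affine line, and each localization at a maximal ideal has dimension and depth
    one. *)

From HB Require Import structures.
Require Import Defs.
From mathcomp Require Import all_boot all_order all_algebra generic_quotient.
From mathcomp Require Import boolp mpoly ring zify.

Set Implicit Arguments.
Unset Strict Implicit.
Unset Printing Implicit Defensive.

Import Order.TTheory GRing.Theory.
Local Open Scope ring_scope.

(** * Noetherianity *)

Section FinitelyGenerated.
Variable A : comNzRingType.

Lemma ideal_genP (s : seq A) a :
  ideal_gen (fun x => x \in s) a <->
  exists c : 'I_(size s) -> A, a = \sum_i c i * s`_i.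
Proof.
split=> [|[c ->]]; last first.
  have [J0 JD JM] := ideal_gen_is_ideal (fun x => x \in s).
  elim/big_ind: _ => // i _; apply: JM.
  by apply: ideal_gen_mem; apply: mem_nth.
apply: (@ideal_gen_sub _ _ (fun a => exists c : 'I_(size s) -> A,
                                      a = \sum_i c i * s`_i)).
  split; first by exists (fun=> 0); rewrite big1 // => i; rewrite mul0r.
  - move=> _ _ [c ->] [d ->]; exists (fun i => c i + d i).
    by rewrite -big_split; apply: eq_bigr => i _; rewrite mulrDl.
  - move=> x _ [c ->]; exists (fun i => x * c i).
    by rewrite mulr_sumr; apply: eq_bigr => i _; rewrite mulrA.
move=> x xs; have lt_xs : (index x s < size s)%N by rewrite index_mem.
exists (fun i => (i == Ordinal lt_xs)%:R).
rewrite (bigD1 (Ordinal lt_xs)) //= eqxx mul1r nth_index // big1 ?addr0 //.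
by move=> i /negbTE->; rewrite mul0r.
Qed.

Definition is_submod q (N : 'rV[A]_q -> Prop) : Prop :=
  [/\ N 0, forall u v, N u -> N v -> N (u + v) & forall a v, N v -> N (a *: v)].

Lemma submod_sum q (N : 'rV[A]_q -> Prop) p (F : 'I_p -> 'rV[A]_q) :
  is_submod N -> (forall i, N (F i)) -> N (\sum_i F i).
Proof. by move=> [N0 ND _] NF; elim/big_ind: _. Qed.

Lemma submod_mulmx q (N : 'rV[A]_q -> Prop) p (B : 'M[A]_(p, q)) u :
  is_submod N -> (forall i, N (row i B)) -> N (u *m B).
Proof.
move=> sN NB; rewrite mulmx_sum_row; apply: submod_sum => // i.
by have [_ _ NZ] := sN; apply: NZ.
Qed.

(** Induction on the rank: the first coordinates of elements of [N] form an ideal with finitely many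
    generators, which are lifted to [N]. Subtracting a combination of the lifts leaves an element
    with first coordinate zero, to which the induction hypothesis applies. *)
Lemma submod_fg (noethA : noetherian A) q (N : 'rV[A]_q -> Prop) :
  is_submod N ->
  exists p (B : 'M[A]_(p, q)), forall v, N v <-> exists u : 'rV_p, v = u *m B.
Proof.
elim: q N => [|q IHq] N sN.
  exists 0%N, 0 => v; split=> [_|_]; first by exists 0; rewrite !thinmx0.
  by rewrite thinmx0; case: sN.
have [N0 ND NZ] := sN.
pose J a := exists w : 'rV_q, N (row_mx a%:M w : 'rV_(1 + q)).
have idJ : is_ideal J.
  split; first by exists 0; rewrite raddf0 row_mx0.
  - move=> a b [w Nw] [w' Nw']; exists (w + w').
    by rewrite raddfD /= -add_row_mx; apply: ND.
  - move=> a b [w Nw]; exists (a *: w).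
    by rewrite -scale_scalar_mx -scale_row_mx; apply: NZ.
have [s sJ] := noethA J idJ.
have /choice[W NW] (a : A) :
    exists w : 'rV_q, J a -> N (row_mx a%:M w : 'rV_(1 + q)).
  by have [[w Nw]|nJ] := pselect (J a); [exists w | exists 0].
have [|p [B NB]] := IHq (fun w => N (row_mx 0 w : 'rV_(1 + q))).
  split; first by rewrite row_mx0.
  - by move=> u v Nu Nv; rewrite -[0]addr0 -add_row_mx; apply: ND.
  - by move=> a v Nv; rewrite -(scaler0 _ a) -scale_row_mx; apply: NZ.
pose B1 : 'M[A]_(size s, 1 + q) := \matrix_i row_mx (s`_i)%:M (W s`_i).
pose B2 : 'M[A]_(p, 1 + q) := row_mx 0 B.
have NB1 i : N (row i B1).
  rewrite rowK; apply: NW; apply/sJ; apply: ideal_gen_mem; exact: mem_nth.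
have NB2 i : N (row i B2).
  rewrite row_row_mx row0; apply/NB; exists (delta_mx 0 i).
  by rewrite rowE.
exists (size s + p)%N, (col_mx B1 B2) => v; split; last first.
  by move=> [u ->]; rewrite -[u]hsubmxK mul_row_col; apply: ND;
     apply: submod_mulmx.
move=> Nv; have Jv : J ((lsubmx (v : 'rV_(1 + q))) 0 0).
  by exists (rsubmx (v : 'rV_(1 + q))); rewrite -mx11_scalar hsubmxK.
have /ideal_genP[c cE] := (sJ _).1 Jv.
pose u1 := \row_i c i.
pose r : 'rV_(1 + q) := v - u1 *m B1.
have Nr : N r.
  by apply: ND => //; rewrite -scaleN1r; apply: NZ; apply: submod_mulmx.
have rE : r = row_mx 0 (rsubmx r).
  rewrite -[LHS]hsubmxK; congr row_mx; rewrite linearB /= [X in X - _]mx11_scalar cE.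
  apply/matrixP => i j; rewrite !ord1 !mxE eqxx mulr1n; apply/eqP.
  rewrite subr_eq0; apply/eqP; apply: eq_bigr => k _.
  by rewrite mxE [B1 _ _]mxE row_mxEl !mxE eqxx mulr1n.
move: Nr; rewrite rE => /NB[u2 u2E]; exists (row_mx u1 u2).
have u2B2 : u2 *m B2 = r.
  by rewrite rE u2E; apply: etrans (mul_mx_row _ _ _) _; rewrite mulmx0.
by rewrite mul_row_col u2B2 addrC subrK.
Qed.

End FinitelyGenerated.

(** * Dickson's lemma and the Hilbert basis theorem *)

Section HilbertBasis.
Variables (K : fieldType) (n : nat).
Local Notation S := {mpoly K[n]}.

(** From any position on, some index attains the minimum of [f] over all later indices; iterating
    this choice gives [g]. *)
Lemma nondecreasing_subsequence (f : nat -> nat) :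
  exists g : nat -> nat, (forall i j, (i < j)%N -> (g i < g j)%N) /\
    forall i j, (i <= j)%N -> (f (g i) <= f (g j))%N.
Proof.
have /choice[idx idxP] (N : nat) :
    exists i, (N <= i)%N /\ forall j, (N <= j)%N -> (f i <= f j)%N.
  have ex : exists v, `[< exists2 i, (N <= i)%N & f i = v >].
    by exists (f N); apply/asboolP; exists N.
  case: (ex_minnP ex) => v /asboolP[i Ni <-] minv; exists i; split=> // j Nj.
  by apply: minv; apply/asboolP; exists j.
pose g := fix g k := idx (if k is k'.+1 then (g k').+1 else 0%N).
have gS k : (g k < g k.+1)%N by have [] := idxP (g k).+1.
have g_lt : {homo g : i j / (i < j)%N >-> (i < j)%N}.
  by apply: homo_ltn => // y x z; apply: ltn_trans.
exists g; split=> // i j; rewrite leq_eqVlt => /orP[/eqP->//|lt_ij].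
have /= := idxP (if i is i'.+1 then (g i').+1 else 0%N).
have -> : idx (if i is i'.+1 then (g i').+1 else 0%N) = g i by case: (i).
move=> [le_g]; apply; apply: leq_trans le_g _; apply: ltnW; exact: g_lt.
Qed.

(** Successive subsequences make one coordinate after another nondecreasing; once all are, the first
    two terms will do. *)
Lemma dickson_seq (u : nat -> 'X_{1..n}) :
  exists i j, (i < j)%N /\ (u i <= u j)%MM.
Proof.
suff /(_ n)[g [g_lt gP]] k : exists g : nat -> nat,
    (forall i j, (i < j)%N -> (g i < g j)%N) /\
    forall (l : 'I_n) i j, (l < k)%N -> (i <= j)%N -> (u (g i) l <= u (g j) l)%N.
  by exists (g 0%N), (g 1%N); split; [apply: g_lt | apply/mnm_lepP => l; apply: gP].
elim: k => [|k [g [g_lt gP]]]; first by exists id.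
have [lt_kn|le_nk] := ltnP k n; last first.
  exists g; split=> // l i j _; apply: gP; exact: leq_trans (ltn_ord l) le_nk.
have [h [h_lt hP]] := nondecreasing_subsequence (fun i => u (g i) (Ordinal lt_kn)).
have h_le i j : (i <= j)%N -> (h i <= h j)%N.
  by rewrite leq_eqVlt => /orP[/eqP->//|/h_lt/ltnW].
exists (g \o h); split=> [i j /h_lt/g_lt //|l i j] /=.
rewrite ltnS leq_eqVlt => /orP[/eqP lk|lt_lk] le_ij; last by apply: gP; auto.
have -> : l = Ordinal lt_kn by apply: val_inj.
exact: hP.
Qed.

Lemma dickson (P : 'X_{1..n} -> Prop) :
  exists s : seq 'X_{1..n}, (forall m, m \in s -> P m) /\
    forall m, P m -> exists2 m', m' \in s & (m' <= m)%MM.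
Proof.
apply/not_existsP => noS.
have /choice[nxt nxtP] (s : seq 'X_{1..n}) :
    exists m, (forall m, m \in s -> P m) ->
      P m /\ forall m', m' \in s -> ~ (m' <= m)%MM.
  have [sP|] := pselect (forall m, m \in s -> P m); last by exists 0%MM.
  have := noS s; rewrite not_andP => -[//|/existsNP[m /not_implyP[Pm nm]]].
  by exists m => _; split=> // m' ms lem; apply: nm; exists m'.
(* If no finite set suffices, each [nxt (l k)] satisfies [P] and is divisible by no earlier choice,
   which contradicts [dickson_seq]. *)
pose l := fix l k := if k is k'.+1 then nxt (l k') :: l k' else [::].
have lP k m : m \in l k -> P m.
  elim: k m => [|k IHk] m //=; rewrite inE => /orP[/eqP->|/IHk//].
  by have [] := nxtP _ IHk.
have [i [j [lt_ij]]] := dickson_seq (fun k => nxt (l k)).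
have [_ /(_ (nxt (l i)))] := nxtP _ (@lP j); apply.
elim: j lt_ij => // j IHj; rewrite ltnS leq_eqVlt /= inE => /orP[/eqP->|/IHj->].
  by rewrite eqxx.
by rewrite orbT.
Qed.

Lemma mlead_cancel (p q : S) : mlead p = mlead q -> mleadc p = mleadc q ->
  p - q = 0 \/ (mlead (p - q) < mlead p)%O.
Proof.
move=> eq_m eq_c; have [->|nz] := eqVneq (p - q) 0; [by left | right].
rewrite lt_neqAle; apply/andP; split; last first.
  by apply: le_trans (mleadB_le _ _) _; rewrite -eq_m joinxx.
apply: contraNneq nz => E; rewrite -mleadc_eq0 E mcoeffB {2}eq_m.
by rewrite -eq_c subrr.
Qed.

(** Dickson's lemma gives finitely many elements of [J] such that the leading monomial of any
    nonzero element is divisible by one of theirs. Cancelling leading terms lowers the leading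
    monomial, and the monomial order is well founded. *)
Lemma mpoly_noetherian : noetherian S.
Proof.
move=> J idJ; have [J0 JD JM] := idJ.
have [ms [msP msJ]] := dickson (fun m => exists f, [/\ J f, f != 0 & mlead f = m]).
have /choice[F FP] (m : 'X_{1..n}) :
    exists f, m \in ms -> [/\ J f, f != 0 & mlead f = m].
  by case: (boolP (m \in ms)) => [/msP[f Pf]|_]; [exists f | exists 0].
pose s := map F ms; exists s => f.
have [G0 GD GM] := ideal_gen_is_ideal (fun x => x \in s).
split; last first.
  by apply: ideal_gen_sub => // _ /mapP[m /FP[Jm _ _] ->].
move: {2}(mlead f) (erefl (mlead f)) => m; elim/(@ltmwf n): m f => m IH f fm Jf.
have [->//|nz_f] := eqVneq f 0.
have [m' m'ms le_m'] := msJ m (ex_intro _ f (And3 Jf nz_f fm)).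
have [JF nzF leadF] := FP m' m'ms.
pose c := mleadc f / mleadc (F m').
have nz_c : c != 0 by rewrite mulf_neq0 ?invr_eq0 ?mleadc_eq0.
pose q := c *: ('X_[m - m'] * F m').
have nz_X : 'X_[m - m'] != 0 :> S by rewrite -msupp_eq0 msuppX.
have qm : mlead q = m.
  by rewrite mleadZ // mleadM // mleadXm leadF submK.
have qc : mleadc q = mleadc f.
  rewrite mleadcZE mleadM // mleadcM mleadXm mcoeffX eqxx mul1r /c divfK //.
  by rewrite mleadc_eq0.
have Gq : ideal_gen (fun x => x \in s) q.
  rewrite /q -mul_mpolyC mulrA; apply: GM; apply: ideal_gen_mem.
  exact: map_f.
have Jq : J q by rewrite /q -mul_mpolyC mulrA; apply: JM.
rewrite -(subrK q f); apply: GD => //.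
have [||->//|] := @mlead_cancel f q; rewrite ?qc ?qm // fm => lt.
apply: IH lt _ erefl _; apply: JD => //.
by rewrite -mulN1r; apply: JM.
Qed.

End HilbertBasis.

(** * Simultaneous resolutions *)

Section SimultaneousResolutions.
Variables (K : fieldType) (n : nat) (x : {mpoly K[n]}).
Local Notation S := {mpoly K[n]}.

Definition saturated q (N : 'rV[S]_q -> Prop) : Prop :=
  forall v, N (x *: v) -> N v.

Definition congr_sub q (N N' : 'rV[S]_q -> Prop) : Prop :=
  forall v, N v -> exists w, N' (v + x *: w).

(** The invariant carried from one syzygy module to the next: [x] is a nonzerodivisor modulo both
    submodules, and both have the same image modulo [x]. *)
Record twin q (N N' : 'rV[S]_q -> Prop) : Prop := Twin {
  twin_subl : is_submod N; twin_subr : is_submod N';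
  twin_satl : saturated N; twin_satr : saturated N';
  twin_lr : congr_sub N N'; twin_rl : congr_sub N' N }.

Lemma congr_lift q (N N' : 'rV[S]_q -> Prop) p (B : 'M[S]_(p, q)) :
  congr_sub N N' -> (forall i, N (row i B)) ->
  exists C : 'M[S]_(p, q), forall i, N' (row i (B + x *: C)).
Proof.
move=> NN' NB; have /choice[w wP] i := NN' _ (NB i).
exists (\matrix_i w i) => i.
by rewrite linearD linearZ /= rowK; apply: wP.
Qed.

(* Generators of each submodule are lifted to the other one and adjoined on both
   sides: the resolutions are not minimal, but no Nakayama argument is needed. *)
Lemma twin_gens q (N N' : 'rV[S]_q -> Prop) : twin N N' ->
  exists p (B C : 'M[S]_(p, q)),
    (forall v, N v <-> exists u : 'rV_p, v = u *m B) /\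
    (forall v, N' v <-> exists u : 'rV_p, v = u *m (B + x *: C)).
Proof.
case=> sN sN' _ _ NN' N'N.
have [p [B NB]] := submod_fg (@mpoly_noetherian K n) sN.
have [p' [B' NB']] := submod_fg (@mpoly_noetherian K n) sN'.
have rB i : N (row i B) by apply/NB; exists (delta_mx 0 i); rewrite rowE.
have rB' i : N' (row i B') by apply/NB'; exists (delta_mx 0 i); rewrite rowE.
have [C NC] := congr_lift NN' rB; have [C' NC'] := congr_lift N'N rB'.
exists (p + p')%N, (col_mx B (B' + x *: C')), (col_mx C (- C')).
rewrite scale_col_mx add_col_mx scalerN addrK.
split=> v; split; [case/NB=> u ->|case=> u ->|case/NB'=> u ->|case=> u ->].
- by exists (row_mx u 0); rewrite mul_row_col mul0mx addr0.
- have [_ ND _] := sN; rewrite -[u]hsubmxK mul_row_col.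
  by apply: ND; apply: submod_mulmx.
- by exists (row_mx 0 u); rewrite mul_row_col mul0mx add0r.
- have [_ ND _] := sN'; rewrite -[u]hsubmxK mul_row_col.
  by apply: ND; apply: submod_mulmx.
Qed.

Lemma ker_submod p q (B : 'M[S]_(p, q)) : is_submod (fun u : 'rV_p => u *m B = 0).
Proof.
split=> [|u v uB vB|a v vB]; first exact: mul0mx.
- by rewrite mulmxDl uB vB addr0.
- by rewrite -scalemxAl vB scaler0.
Qed.

Lemma ker_saturated p q (B : 'M[S]_(p, q)) : x != 0 ->
  saturated (fun u : 'rV_p => u *m B = 0).
Proof.
move=> nz_x u; rewrite -scalemxAl => /matrixP E; apply/matrixP => i j.
by apply: (mulfI nz_x); move: (E i j); rewrite !mxE mulr0.
Qed.

(** If [u B = 0], then [u (B + x C) = x (u C)] lies in [N'], hence so does [u C] by saturation.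
    Writing [u C = w (B + x C)], the vector [u - x w] is killed by [B + x C]. *)
Lemma ker_congr q (N' : 'rV[S]_q -> Prop) p (B C : 'M[S]_(p, q)) :
  saturated N' -> (forall v, N' v <-> exists u : 'rV_p, v = u *m (B + x *: C)) ->
  congr_sub (fun u : 'rV_p => u *m B = 0) (fun u => u *m (B + x *: C) = 0).
Proof.
move=> satN' N'B u uB.
have /N'B[w wE] : N' (u *m C).
  apply: satN'; apply/N'B; exists u.
  by rewrite mulmxDr uB add0r -scalemxAr.
exists (- w); rewrite mulmxDl mulmxDr uB add0r scalerN mulNmx -scalemxAl -wE.
by rewrite -scalemxAr subrr.
Qed.

Lemma ker_twin q (N N' : 'rV[S]_q -> Prop) p (B C : 'M[S]_(p, q)) :
  x != 0 -> twin N N' ->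
  (forall v, N v <-> exists u : 'rV_p, v = u *m B) ->
  (forall v, N' v <-> exists u : 'rV_p, v = u *m (B + x *: C)) ->
  twin (fun u : 'rV_p => u *m B = 0) (fun u : 'rV_p => u *m (B + x *: C) = 0).
Proof.
move=> nz_x tw NB N'B; split; do ?[exact: ker_submod|exact: ker_saturated].
  by apply: (ker_congr (N' := N')) => //; case: tw.
have [_ _ satN _ _ _] := tw.
(* The converse is the same argument with the roles exchanged, as [B = (B + x C) + x (- C)]. *)
have NB' v : N v <-> exists u : 'rV_p, v = u *m (B + x *: C + x *: - C).
  by rewrite scalerN addrK.
by have := ker_congr satN NB'; rewrite scalerN addrK.
Qed.

(** Bundling the rank allows plain iteration, although the ambient free module changes at each
    step. *)
Record stage := Stage {
  st_rank : nat;
  st_l : 'rV[S]_st_rank -> Prop;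
  st_r : 'rV[S]_st_rank -> Prop;
  st_twin : twin st_l st_r }.

Definition next_rank (s : stage) : nat := projT1 (cid (twin_gens (st_twin s))).

Definition stage_gens (s : stage) : 'M[S]_(next_rank s, st_rank s) :=
  projT1 (cid (projT2 (cid (twin_gens (st_twin s))))).

Definition stage_corr (s : stage) : 'M[S]_(next_rank s, st_rank s) :=
  projT1 (cid (projT2 (cid (projT2 (cid (twin_gens (st_twin s))))))).

Lemma stage_gensP (s : stage) :
  (forall v, st_l v <-> exists u : 'rV_(next_rank s), v = u *m stage_gens s) /\
  (forall v, st_r v <-> exists u : 'rV_(next_rank s),
               v = u *m (stage_gens s + x *: stage_corr s)).
Proof. exact: projT2 (cid (projT2 (cid (projT2 (cid (twin_gens (st_twin s))))))). Qed.

Variable nz_x : x != 0.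

Definition next_stage (s : stage) : stage :=
  Stage (ker_twin nz_x (st_twin s) (stage_gensP s).1 (stage_gensP s).2).

Hypothesis x0 : x@_0%MM = 0.
Variables I J : S -> Prop.
Hypotheses (idI : is_ideal I) (idJ : is_ideal J).
Hypotheses (satI : forall f, I (x * f) -> I f) (satJ : forall f, J (x * f) -> J f).
Hypotheses (IJ : forall f, I f -> exists g, J (f + x * g)).
Hypotheses (JI : forall f, J f -> exists g, I (f + x * g)).

Definition ideal_row (I : S -> Prop) (v : 'rV[S]_1) : Prop := I (v 0 0).

Lemma ideal_row_submod I0 : is_ideal I0 -> is_submod (ideal_row I0).
Proof.
case=> I00 ID IM; rewrite /ideal_row; split=> [|u v|a v]; rewrite !mxE //.
  exact: ID.
exact: IM.
Qed.

Lemma ideal_row_saturated I0 :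
  (forall f, I0 (x * f) -> I0 f) -> saturated (ideal_row I0).
Proof. by move=> sat v; rewrite /ideal_row mxE; apply: sat. Qed.

Lemma ideal_row_congr I0 J0 :
  (forall f, I0 f -> exists g, J0 (f + x * g)) ->
  congr_sub (ideal_row I0) (ideal_row J0).
Proof.
move=> IJ0 v /IJ0[g Jg]; exists (const_mx g).
by rewrite /ideal_row !mxE.
Qed.

Lemma ideal_twin : twin (ideal_row I) (ideal_row J).
Proof.
split; do ?[exact: ideal_row_submod|exact: ideal_row_saturated];
  exact: ideal_row_congr.
Qed.

Definition res_stage (i : nat) : stage := iter i next_stage (Stage ideal_twin).

Lemma ideal_augP (I0 : S -> Prop) p (B : 'M[S]_(p, 1)) :
  (forall v, ideal_row I0 v <-> exists u : 'rV_p, v = u *m B) ->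
  forall f, I0 f <-> exists u : 'rV_p, u *m B = f%:M.
Proof.
move=> IB f; have -> : I0 f = ideal_row I0 f%:M.
  by rewrite /ideal_row mxE eqxx mulr1n.
by rewrite IB; split=> -[u E]; exists u.
Qed.

(** Stage 0 is the ideal itself inside [S^1], and its generators form the augmentation; this is why
    the ranks and differentials start at stage 1. *)
Definition resl : free_resolution I :=
  @FreeResolution K n I (fun i => st_rank (res_stage i.+1))
    (stage_gens (res_stage 0)) (fun i => stage_gens (res_stage i.+1))
    (ideal_augP (stage_gensP (res_stage 0)).1)
    ((stage_gensP (res_stage 1)).1)
    (fun i => (stage_gensP (res_stage i.+2)).1).

Definition resr : free_resolution J :=
  @FreeResolution K n J (fun i => st_rank (res_stage i.+1))
    (stage_gens (res_stage 0) + x *: stage_corr (res_stage 0))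
    (fun i => stage_gens (res_stage i.+1) + x *: stage_corr (res_stage i.+1))
    (ideal_augP (stage_gensP (res_stage 0)).2)
    ((stage_gensP (res_stage 1)).2)
    (fun i => (stage_gensP (res_stage i.+2)).2).

(** The differentials differ by multiples of [x], which has no constant term, so they become equal
    after tensoring with [K]. *)
Lemma tor_dim_twin i : tor_dim resl i = tor_dim resr i.
Proof.
have E j : fr_diffK resr j = fr_diffK resl j.
  rewrite /fr_diffK /=; apply/matrixP => a b; rewrite !mxE.
  by rewrite mcoeffD rmorphM /= x0 mul0r addr0.
by case: i => [|i]; rewrite /tor_dim !E.
Qed.

Lemma betti_twin i : exists c, betti I i c /\ betti J i c.
Proof.
exists (tor_dim resl i); split; first by exists resl.
by exists resr; rewrite tor_dim_twin.
Qed.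

End SimultaneousResolutions.

(** * Factorizations in a semigroup with large multiplicity *)

Section Monomials.
Variable s : nat.
Implicit Types (m : 'X_{1..s}) (b : 'I_s -> nat).

Definition wt b m : nat := (\sum_i m i * b i)%N.

Lemma wt0 b : wt b 0%MM = 0%N.
Proof. by rewrite /wt big1 // => i _; rewrite mnm0E. Qed.

Lemma wtD b m1 m2 : wt b (m1 + m2)%MM = (wt b m1 + wt b m2)%N.
Proof.
by rewrite /wt -big_split /=; apply: eq_bigr => i _; rewrite mnmDE mulnDl.
Qed.

HB.instance Definition _ b := isMeasure.Build s (wt b) (wt0 b) (wtD b).

Lemma wtU b i : wt b U_(i)%MM = b i.
Proof.
rewrite /wt (bigD1 i) //= mnm1E eqxx mul1n big1 ?addn0 // => j ne_ji.
by rewrite mnm1E eq_sym (negbTE ne_ji).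
Qed.

Lemma wtMn b m k : wt b (m *+ k)%MM = (wt b m * k)%N.
Proof.
by elim: k => [|k IHk]; rewrite ?muln0 ?wt0 // mulmS wtD IHk mulnS.
Qed.

Lemma wt_sub b m1 m : (m1 <= m)%MM -> wt b (m - m1)%MM = (wt b m - wt b m1)%N.
Proof. by move=> /submK {2}<-; rewrite wtD addnK. Qed.

Lemma mdeg_sub m1 m : (m1 <= m)%MM -> mdeg (m - m1)%MM = (mdeg m - mdeg m1)%N.
Proof. by move=> /submK {2}<-; rewrite mdegD addnK. Qed.

Lemma leq_wt b m1 m : (m1 <= m)%MM -> (wt b m1 <= wt b m)%N.
Proof. by move=> /submK<-; rewrite wtD leq_addl. Qed.

Lemma wt_mdeg b c m : (forall i, b i = c) -> wt b m = (mdeg m * c)%N.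
Proof.
by move=> bc; rewrite mdegE big_distrl; apply: eq_bigr => i _; rewrite bc.
Qed.

Lemma leq_wt_weights b c m : (forall i, m i != 0%N -> b i <= c i)%N ->
  (wt b m <= wt c m)%N.
Proof.
move=> le_bc; apply: leq_sum => i _; have := le_bc i.
by case: (m i) => // k /(_ isT); rewrite leq_mul2l.
Qed.

Lemma monomial_chain m : exists mu : nat -> 'X_{1..s},
  (forall i, i <= mdeg m -> mdeg (mu i) = i /\ (mu i <= m)%MM)%N /\
  (forall i j, i <= j <= mdeg m -> (mu i <= mu j)%MM)%N.
Proof.
move: {2}(mdeg m) (erefl (mdeg m)) => d; elim: d m => [|d IHd] m dm.
  exists (fun=> 0%MM); split=> i; last by move=> *; apply: lepm_refl.
  rewrite dm leqn0 => /eqP->; split; first exact: mdeg0.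
  by apply/mnm_lepP => j; rewrite mnm0E.
have /existsP[i mi] : [exists i, m i != 0%N].
  rewrite -negb_forall; apply/negP => /forallP m0; move: dm.
  by rewrite mdegE big1 // => i _; apply/eqP; rewrite -[_ == _]negbK m0.
have leU : (U_(i) <= m)%MM by rewrite lep1mP.
have dU : mdeg (m - U_(i))%MM = d by rewrite mdeg_sub // dm mdeg1 subn1.
have [mu [mu1 mu2]] := IHd _ dU; rewrite dm.
exists (fun j => if (j <= d)%N then mu j else m); split=> j => [le_j|k].
  case: leqP => [le_jd|lt_dj].
    have [-> le] := mu1 j (leq_trans le_jd (eq_leq (esym dU))); split=> //.
    exact: lepm_trans le (lem_subr _ _).
  by split; [rewrite dm; lia | apply: lepm_refl].
case/andP=> le_jk le_k; case: (leqP k d) => [le_kd|lt_dk].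
  by rewrite (leq_trans le_jk le_kd); apply: mu2; rewrite dU le_jk.
case: leqP => [le_jd|_]; last exact: lepm_refl.
have [_ le] := mu1 j (leq_trans le_jd (eq_leq (esym dU))).
exact: lepm_trans le (lem_subr _ _).
Qed.

(** Pigeonhole on a chain of divisors of degrees [0] to [e]: two of these [e + 1] monomials have
    weights congruent modulo [e], and [m1] is their quotient. *)
Lemma zero_sum_submonomial b (e : nat) m : (0 < e <= mdeg m)%N ->
  exists m1, [/\ (m1 <= m)%MM, (0 < mdeg m1)%N & e %| wt b m1]%N.
Proof.
case: e => // e le_em; have [mu [mu1 mu2]] := monomial_chain m.
pose r (i : 'I_e.+2) : 'I_e.+1 := inord (wt b (mu i) %% e.+1).
have /injectivePn[i [j ne_ij eq_ij]] : ~~ injectiveb r.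
  apply/injectiveP => /leq_card; rewrite !card_ord; lia.
wlog lt_ij : i j ne_ij eq_ij / (i < j)%N.
  move=> W; case: (ltngtP i j) => [/W|/W|/val_inj E]; last by rewrite E eqxx in ne_ij.
    exact.
  by apply; rewrite // eq_sym.
have le_j : (j <= mdeg m)%N by have := ltn_ord j; lia.
have le_i : (i <= mdeg m)%N by lia.
have le_mu : (mu i <= mu j)%MM by apply: mu2; lia.
exists (mu j - mu i)%MM; split.
- by apply: lepm_trans (lem_subr _ _) _; have [] := mu1 j le_j.
- by rewrite mdeg_sub // (mu1 j le_j).1 (mu1 i le_i).1 subn_gt0.
- rewrite wt_sub // -eqn_mod_dvd ?leq_wt // eq_sym.
  have /(congr1 val) := eq_ij; rewrite /= !inordK ?ltn_pmod // => ->.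
  exact: eqxx.
Qed.

End Monomials.

(** * Long factorizations through the smallest generator *)

Section LongFactorizations.
Variables (s : nat) (b : 'I_s -> nat) (i0 il : 'I_s).
Hypothesis b_pos : (0 < b i0)%N.
Hypothesis b_min : forall i, (b i0 <= b i)%N.
Hypothesis b_max : forall i, i != il -> (b i < b il)%N.
Hypothesis b_gap : ((b il - b i0) ^ 2 <= b i0)%N.

Let e := (b il - b i0)%N.
Let v i := (b i - b i0)%N.

Let wtE m : wt b m = (mdeg m * b i0 + wt v m)%N.
Proof.
rewrite -(@wt_mdeg _ (fun=> b i0)) // /wt -big_split /=; apply: eq_bigr => i _.
by rewrite -mulnDr subnKC.
Qed.

Let wt_le m : (wt v m <= mdeg m * e)%N.
Proof.
rewrite -(@wt_mdeg _ (fun=> e)) //; apply: leq_wt_weights => i _.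
have [->|/b_max] := eqVneq i il; rewrite /v /e; lia.
Qed.

(* Among [e] generators other than the largest one, some have gaps to [b i0]
   that add up to a multiple [q * e]; trading them for [q] copies of the largest
   generator and copies of the smallest one keeps length and weight.  With fewer
   than [e] such generators, the weight is too large for a shorter
   factorization to exist. *)
Lemma longer_factorization m m' : wt b m = wt b m' -> (mdeg m' < mdeg m)%N ->
  exists m'', [/\ wt b m'' = wt b m, mdeg m'' = mdeg m & m'' i0 != 0%N].
Proof.
move=> eq_w lt_d; pose ml := (U_(il) *+ m il)%MM.
have le_ml : (ml <= m)%MM.
  apply/mnm_lepP => i; rewrite mulmnE mnm1E; case: eqP => [<-|_]; rewrite ?mul1n //.
pose mo := (m - ml)%MM.
have dmo : mdeg mo = (mdeg m - m il)%N by rewrite mdeg_sub // mdegMn mdeg1 mul1n.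
have wml : (m il * e <= wt v m)%N.
  by apply: leq_trans (leq_wt v le_ml); rewrite wtMn wtU mulnC.
have le_mil : (m il <= mdeg m)%N by have := leq_wt (fun=> 1%N) le_ml;
  rewrite wtMn wtU mul1n (@wt_mdeg _ _ 1%N) // muln1.
(* With [e = 0] the weight would be [b i0] times the length, so equal weights would force equal
   lengths. *)
have e_gt0 : (0 < e)%N.
  move: (wtE m) (wtE m') (wt_le m) (wt_le m'); rewrite eq_w; case: (e) => // E1 E2.
  rewrite !muln0 !leqn0 => /eqP E3 /eqP E4; move: E1; rewrite E2 E3 E4 !addn0.
  move/eqP; rewrite eqn_pmul2r //; lia.
have [le_e|lt_e] := leqP e (mdeg mo).
  have [|m1 [le_m1 d1 /dvdnP[q qE]]] := @zero_sum_submonomial s v e mo; first lia.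
  (* The variables of [m1] have gaps at most [e - 1], so at least one copy of the smallest generator
     comes out of the exchange. *)
  have lt_q : (q < mdeg m1)%N.
    have : (wt v m1 <= mdeg m1 * e.-1)%N.
      rewrite -(@wt_mdeg _ (fun=> e.-1)) //; apply: leq_wt_weights => i m1i.
      have ne_i : i != il.
        apply: contraNneq m1i => ->; move/mnm_lepP/(_ il): le_m1.
        by rewrite mnmBE mulmnE mnm1E eqxx mul1n subnn leqn0.
      have := b_max ne_i; have := b_min i; rewrite /v; move: e_gt0; rewrite /e; lia.
    rewrite qE; nia.
  have le_m1m : (m1 <= m)%MM by apply: lepm_trans le_m1 (lem_subr _ _).
  exists ((m - m1) + (U_(il) *+ q + U_(i0) *+ (mdeg m1 - q)))%MM; split.
  - rewrite !wtD !wtMn !wtU wt_sub //.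
    have := leq_wt b le_m1m; have := wtE m1; rewrite qE.
    have : b il = (b i0 + e)%N.
      by have := b_min il; rewrite /e; lia.
    nia.
  - rewrite !mdegD !mdegMn !mdeg1 mdeg_sub //.
    have := leq_wt (fun=> 1%N) le_m1m; rewrite !(@wt_mdeg _ _ 1%N) //; lia.
  - rewrite !mnmDE !mulmnE !mnm1E eqxx; lia.
(* Equal weights give [(mdeg m - mdeg m') * b i0 <= (mdeg m' - m il) * e]. The right side is below
   [e ^ 2] because [mdeg m - m il < e], against [b_gap]. *)
have := wtE m; have := wtE m'; have := wt_le m'; rewrite -eq_w.
move: b_gap; rewrite -/e dmo in lt_e *; nia.
Qed.

(** Quantifying over monomials leaves [rep] unconstrained at numbers that are not weights. *)
Definition is_rep (rep : nat -> 'X_{1..s}) : Prop := forall m,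
  [/\ wt b (rep (wt b m)) = wt b m, (mdeg m <= mdeg (rep (wt b m)))%N
    & (mdeg m < mdeg (rep (wt b m)))%N -> rep (wt b m) i0 != 0%N].

Lemma leq_mdeg_wt m : (mdeg m <= wt b m)%N.
Proof.
rewrite -[mdeg m]muln1 -(@wt_mdeg _ (fun=> 1%N)) //.
by apply: leq_wt_weights => i _; apply: leq_trans b_pos (b_min i).
Qed.

(** Lengths are bounded by the weight, so a longest factorization exists; if a shorter one exists
    too, [longer_factorization] replaces the longest by one of the same length through [i0]. *)
Lemma rep_exists : exists rep, is_rep rep.
Proof.
suff /choice[rep repP] (h : nat) : exists r, forall m, wt b m = h ->
    [/\ wt b r = h, mdeg m <= mdeg r & mdeg m < mdeg r -> r i0 != 0]%N.
  by exists rep => m; apply: repP.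
have [[m0 m0h]|no] := pselect (exists m, wt b m = h); last first.
  by exists 0%MM => m mh; case: no; exists m.
pose P d := `[< exists2 m, wt b m = h & mdeg m = d >].
have exP : exists d, P d by exists (mdeg m0); apply/asboolP; exists m0.
have ubP d : P d -> (d <= h)%N.
  by move=> /asboolP[m <- <-]; apply: leq_mdeg_wt.
case: (ex_maxnP exP ubP) => d /asboolP[r rh rd] maxd.
have le_d m : wt b m = h -> (mdeg m <= d)%N.
  by move=> mh; apply: maxd; apply/asboolP; exists m.
have [[m' m'h lt_m']|no] :=
    pselect (exists2 m', wt b m' = h & (mdeg m' < d)%N).
  have [||r' [r'h r'd r'0]] := @longer_factorization r m'; rewrite ?rh ?m'h ?rd //.
  by exists r' => m mh; rewrite r'd rd r'h rh; split=> //; apply: le_d.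
exists r => m mh; rewrite rd; split=> //; first exact: le_d.
by move=> lt_m; case: no; exists m.
Qed.

End LongFactorizations.

(** * Toric ideals and their initial ideals *)

Section MonomialExtension.
Variables (K : fieldType) (s : nat) (V : lmodType K) (c : 'X_{1..s} -> V).
Implicit Types (f : {mpoly K[s]}) (m : 'X_{1..s}).

Definition mlin f : V := \sum_(m <- msupp f) f@_m *: c m.

Lemma mlin_widen f (r : seq 'X_{1..s}) : uniq r -> {subset msupp f <= r} ->
  mlin f = \sum_(m <- r) f@_m *: c m.
Proof.
move=> Ur sub; rewrite (bigID (mem (msupp f))) /= [X in _ + X]big1 ?addr0.
  rewrite -big_filter; apply: perm_big; apply: uniq_perm; rewrite ?filter_uniq //.
  by move=> m; rewrite mem_filter andb_idr //; apply: sub.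
by move=> m /memN_msupp_eq0->; rewrite scale0r.
Qed.

Lemma mlin_is_linear : linear mlin.
Proof.
move=> a f g; pose r := undup (msupp f ++ msupp g ++ msupp (a *: f + g)).
have Ur : uniq r by apply: undup_uniq.
rewrite !(@mlin_widen _ r) //; try by move=> m; rewrite mem_undup !mem_cat => ->;
  rewrite ?orbT.
rewrite scaler_sumr -big_split; apply: eq_bigr => m _ /=.
by rewrite mcoeffD mcoeffZ scalerDl scalerA.
Qed.

HB.instance Definition _ :=
  GRing.isLinear.Build K {mpoly K[s]} V *:%R mlin mlin_is_linear.

Lemma mlinX m : mlin 'X_[m] = c m.
Proof. by rewrite /mlin msuppX big_seq1 mcoeffX eqxx scale1r. Qed.

End MonomialExtension.

Section InitialForms.
Variables (K : fieldType) (s : nat).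
Implicit Types (f : {mpoly K[s]}) (m : 'X_{1..s}).

Lemma mcoeff_pihomog (mf : measure s) d f m :
  (pihomog mf d f)@_m = if mf m == d then f@_m else 0.
Proof.
rewrite {2}[f]mpolyE pihomogE !raddf_sum /= big_mkcond /=.
case: ifPn => md; last first.
  apply: big1 => m' _; case: ifP => // m'd; rewrite mcoeffZ mcoeffX.
  by case: eqP => [E|]; rewrite ?mulr0 //; move: md; rewrite -E m'd.
apply: eq_bigr => m' _; case: ifPn => // m'd; rewrite mcoeffZ mcoeffX.
by case: eqP => [E|]; rewrite ?mulr0 //; move: m'd; rewrite E md.
Qed.

Lemma mindeg_le f m : m \in msupp f -> (mindeg f <= mdeg m)%N.
Proof.
rewrite /mindeg; elim: (msupp f) (msize f) => // m' r IHr d.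
rewrite inE big_cons geq_min => /orP[/eqP->|mr]; first by rewrite leqnn.
by rewrite IHr ?orbT.
Qed.

Lemma mindegE f d m : m \in msupp f -> mdeg m = d ->
  (forall m', m' \in msupp f -> d <= mdeg m')%N -> mindeg f = d.
Proof.
move=> mf md min_d; apply/eqP; rewrite eqn_leq -{1}md mindeg_le //=.
rewrite /mindeg big_seq_cond; elim/big_ind: _ => [|u w du dw|m' /andP[m'f _]].
- by rewrite -md; apply: ltnW; apply: msize_mdeg_lt.
- by rewrite leq_min du.
- exact: min_d.
Qed.

End InitialForms.

Section Toric.
Variables (K : fieldType) (s : nat) (b : 'I_s -> nat) (i0 : 'I_s).
Variable rep : nat -> 'X_{1..s}.
Hypothesis b_pos : forall i, (0 < b i)%N.
Hypothesis repP : is_rep b i0 rep.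
Local Notation S := {mpoly K[s]}.
Local Notation wt := (wt b).
Implicit Types (f g : S) (m : 'X_{1..s}).

Definition monoid_map f : {poly K} :=
  mmap (@polyC K) (fun i : 'I_s => 'X^(b i)) f.

HB.instance Definition _ := GRing.RMorphism.copy monoid_map
  (mmap (@polyC K) (fun i : 'I_s => 'X^(b i))).

Lemma monoid_mapX m : monoid_map 'X_[m] = 'X^(wt m).
Proof.
rewrite /monoid_map mmapX /mmap1 /wt.
rewrite (eq_bigr (fun i => 'X^(m i * b i))).
  by rewrite -(big_morph (fun k => 'X^k) (exprD _) (expr0 _)).
by move=> i _; rewrite -exprM mulnC.
Qed.

Lemma monoid_mapE f : monoid_map f = mlin (fun m => 'X^(wt m)) f.
Proof.
rewrite {1}[f]mpolyE raddf_sum; apply: eq_bigr => m _ /=.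
by rewrite /monoid_map mmapZ -/(monoid_map _) monoid_mapX mul_polyC.
Qed.

Definition is_max m : bool := mdeg m == mdeg (rep (wt m)).

(** A model of [S / I^*] as a vector space, with one basis element per weight. The map is only
    linear: a product of two monomials of maximal length need not have maximal length. *)
Definition max_map f : {poly K} :=
  mlin (fun m => if is_max m then 'X^(wt m) else 0) f.

HB.instance Definition _ := GRing.Linear.copy max_map
  (mlin (fun m => if is_max m then 'X^(wt m) else 0)).

Lemma max_mapE f :
  max_map f = \sum_(m <- msupp f) f@_m *: (if is_max m then 'X^(wt m) else 0).
Proof. by []. Qed.

Lemma max_mapX m : max_map 'X_[m] = if is_max m then 'X^(wt m) else 0.
Proof. exact: mlinX. Qed.

Lemma wt_rep m : wt (rep (wt m)) = wt m. Proof. by have [] := repP m. Qed.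

Lemma leq_mdeg_rep m m' : wt m = wt m' -> (mdeg m <= mdeg (rep (wt m')))%N.
Proof. by move=> <-; have [] := repP m. Qed.

Lemma is_max_rep m : is_max (rep (wt m)).
Proof. by rewrite /is_max wt_rep. Qed.

(** If the maximal length grew by more than one, the new representative would be longer than
    [U_(i0) + r], hence divisible by the variable [i0]; dividing by it would give a factorization of
    [wt m] longer than [r]. This makes that variable a nonzerodivisor modulo the initial ideal. *)
Lemma mdeg_rep_shift m :
  mdeg (rep (wt (U_(i0) + m)%MM)) = (mdeg (rep (wt m))).+1.
Proof.
set r := rep (wt m); set m1 := (U_(i0) + m)%MM.
have wr : wt (U_(i0) + r)%MM = wt m1 by rewrite !wtD wt_rep.
have dr : mdeg (U_(i0) + r)%MM = (mdeg r).+1 by rewrite mdegD mdeg1.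
have [_] := repP (U_(i0) + r)%MM; rewrite dr wr => le lt0.
apply/eqP; rewrite eqn_leq le andbT leqNgt; apply/negP => lt.
have leU : (U_(i0) <= rep (wt m1))%MM by rewrite lep1mP; apply: lt0.
have w2 : wt (rep (wt m1) - U_(i0))%MM = wt m.
  by rewrite wt_sub // wt_rep wtD wtU addKn.
have := leq_mdeg_rep w2; rewrite mdeg_sub // mdeg1 -/r; lia.
Qed.

Lemma is_max_shift m : is_max (U_(i0) + m)%MM = is_max m.
Proof. by rewrite /is_max mdeg_rep_shift mdegD mdeg1 eqSS. Qed.

(** Otherwise replacing [m'] by its representative would lengthen the product. *)
Lemma is_max_addr m m' : is_max (m + m')%MM -> is_max m'.
Proof.
rewrite /is_max => /eqP E; rewrite eqn_leq (leq_mdeg_rep (erefl _)) /=.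
have : wt (m + rep (wt m'))%MM = wt (m + m')%MM by rewrite !wtD wt_rep.
by move/leq_mdeg_rep; rewrite -E !mdegD leq_add2l.
Qed.

Definition bin m : S := 'X_[m] - 'X_[rep (wt m)].

Definition inbin m : S := if is_max m then bin m else 'X_[m].

Definition toricI f : Prop := monoid_map f = 0.

(** Identified with the initial ideal in [initideal_toric]. *)
Definition maxI f : Prop := max_map f = 0.

Lemma bin_toric m : toricI (bin m).
Proof. by rewrite /toricI /bin rmorphB /= !monoid_mapX wt_rep subrr. Qed.

Lemma inbin_max m : maxI (inbin m).
Proof.
rewrite /maxI /inbin; case: ifPn => mm; last by rewrite max_mapX (negbTE mm).
by rewrite raddfB /= !max_mapX mm is_max_rep wt_rep subrr.
Qed.

(** The linear map ['X^h |-> 'X_[rep h]], cut off at a bound [N] that exceeds all weights to which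
    it is applied. *)
Definition rep_sum (N : nat) (p : {poly K}) : S :=
  \sum_(h < N) p`_h *: 'X_[rep h].

Lemma rep_sum_is_linear N : linear (rep_sum N).
Proof.
move=> a p q; rewrite scaler_sumr -big_split; apply: eq_bigr => h _ /=.
by rewrite coefD coefZ scalerDl scalerA.
Qed.

HB.instance Definition _ N :=
  GRing.isLinear.Build K {poly K} S *:%R (rep_sum N) (rep_sum_is_linear N).

Lemma rep_sumX N h : (h < N)%N -> rep_sum N 'X^h = 'X_[rep h].
Proof.
move=> lt_h; rewrite /rep_sum (bigD1 (Ordinal lt_h)) //= coefXn eqxx scale1r.
rewrite big1 ?addr0 // => j; rewrite -val_eqE /= coefXn => /negbTE->.
exact: scale0r.
Qed.

(** Subtracting the right side replaces every monomial of [f] by the representative of its weight;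
    the result is [rep_sum] of [monoid_map f], which is zero. *)
Lemma toricI_span f : toricI f -> f = \sum_(m <- msupp f) f@_m *: bin m.
Proof.
move=> If; pose N := mmeasure wt f.
rewrite {1}[f]mpolyE; apply/eqP; rewrite -subr_eq0 -sumrB.
apply/eqP; transitivity (rep_sum N (monoid_map f)); last by rewrite If raddf0.
rewrite monoid_mapE /mlin [RHS]raddf_sum; apply: eq_big_seq => m mf /=.
rewrite [RHS]linearZ /= rep_sumX; last exact: mmeasure_mnm_lt.
by rewrite -scalerBr /bin opprB addrC subrK.
Qed.

Lemma maxI_span f : maxI f -> f = \sum_(m <- msupp f) f@_m *: inbin m.
Proof.
move=> If; pose N := mmeasure wt f.
rewrite {1}[f]mpolyE; apply/eqP; rewrite -subr_eq0 -sumrB.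
apply/eqP; transitivity (rep_sum N (max_map f)); last by rewrite If raddf0.
rewrite /max_map /mlin [RHS]raddf_sum; apply: eq_big_seq => m mf /=.
rewrite -scalerBr [RHS]linearZ /=; congr (_ *: _); rewrite /inbin.
case: ifP => _; last by rewrite subrr raddf0.
rewrite rep_sumX; last exact: mmeasure_mnm_lt.
by rewrite /bin opprB addrC subrK.
Qed.

Lemma toricI_ideal : is_ideal toricI.
Proof.
split; rewrite /toricI; first exact: rmorph0.
- by move=> f g If Ig; rewrite rmorphD /= If Ig addr0.
- by move=> f g Ig; rewrite rmorphM /= Ig mulr0.
Qed.

Lemma mulXE m f : 'X_[m] * f = \sum_(m' <- msupp f) f@_m' *: 'X_[m + m'].
Proof.
rewrite {1}[f]mpolyE mulr_sumr; apply: eq_bigr => m' _.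
by rewrite -scalerAr -mpolyXD.
Qed.

(** The right side depends on [f] only through [max_map f], so the kernel is an ideal. If the
    maximal lengths add up, [m + m'] of weight [h] is maximal exactly when [m'] is; if they do not,
    no such product is maximal, by [is_max_addr]. *)
Lemma max_map_mulX m f h : (max_map ('X_[m] * f))`_h =
  if ((wt m <= h) && (mdeg m + mdeg (rep (h - wt m)) == mdeg (rep h)))%N
  then (max_map f)`_(h - wt m) else 0.
Proof.
rewrite mulXE [max_map (\sum_(_ <- _) _)]raddf_sum /= [max_map f]max_mapE.
rewrite !coef_sum; case: ifPn => [|nle].
  case/andP=> le_m /eqP E; apply: eq_bigr => m' _.
  rewrite linearZ /= max_mapX !coefZ; congr (_ * _).
  have [wm'|ne_w] := eqVneq (wt m') (h - wt m)%N.
    rewrite /is_max wm' wtD wm' subnKC // mdegD -E eqn_add2l.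
    by case: ifP; rewrite ?coef0 // !coefXn !eqxx.
  rewrite (_ : ((if _ then 'X^(wt m') else 0 : {poly K})`_(h - wt m) = 0)); last first.
    by case: ifP; rewrite ?coef0 // coefXn eq_sym (negbTE ne_w).
  case: ifP; rewrite ?coef0 // coefXn wtD.
  by case: eqP => // E'; case/eqP: ne_w; rewrite E' addKn.
rewrite big1 // => m' _; rewrite linearZ /= max_mapX coefZ.
case: ifP => [mm|_]; last by rewrite coef0 mulr0.
rewrite coefXn; case: eqP => [E|]; last by rewrite mulr0.
case/negP: nle; rewrite E wtD leq_addr addKn /=.
have /eqP <- := is_max_addr mm; rewrite -mdegD -wtD; exact: mm.
Qed.

Lemma maxI_ideal : is_ideal maxI.
Proof.
split; rewrite /maxI; first exact: raddf0.
- by move=> f g If Ig; rewrite raddfD /= If Ig addr0.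
- move=> f g Ig; rewrite [f]mpolyE mulr_suml raddf_sum big1 // => m _ /=.
  rewrite -scalerAl linearZ /=; apply/polyP => h.
  by rewrite coefZ max_map_mulX Ig !coef0 if_same mulr0.
Qed.

Lemma toricI_saturated f : toricI ('X_i0 * f) -> toricI f.
Proof.
rewrite /toricI rmorphM /= monoid_mapX => /eqP; rewrite mulf_eq0.
by rewrite expf_eq0 polyX_eq0 andbF => /eqP.
Qed.

Lemma max_map_shift f : max_map ('X_i0 * f) = 'X^(b i0) * max_map f.
Proof.
rewrite mulXE raddf_sum /= [max_map f]max_mapE mulr_sumr; apply: eq_bigr => m _.
rewrite linearZ /= max_mapX is_max_shift -scalerAr; congr (_ *: _).
by case: ifP; rewrite ?mulr0 // wtD wtU exprD.
Qed.

Lemma maxI_saturated f : maxI ('X_i0 * f) -> maxI f.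
Proof.
rewrite /maxI max_map_shift => /eqP; rewrite mulf_eq0.
by rewrite expf_eq0 polyX_eq0 andbF => /eqP.
Qed.

Definition bin_corr m : S :=
  if is_max m then 0 else 'X_[rep (wt m) - U_(i0)].

(** For [m] not maximal the representative is divisible by the variable [i0], so omitting it changes
    the binomial by a multiple of that variable. *)
Lemma inbinE m : inbin m = bin m + 'X_i0 * bin_corr m.
Proof.
rewrite /inbin /bin_corr; case: ifPn => mm; first by rewrite mulr0 addr0.
have [_ le lt] := repP m.
rewrite -mpolyXD addmC submK; last by rewrite lep1mP lt // ltn_neqAle mm.
by rewrite /bin subrK.
Qed.

Lemma toric_max f : toricI f -> exists g, maxI (f + 'X_i0 * g).
Proof.
move/toricI_span=> fE; have [M0 MD MM] := maxI_ideal.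
exists (\sum_(m <- msupp f) f@_m *: bin_corr m).
rewrite mulr_sumr {1}fE -big_split; elim/big_ind: _ => // m _ /=.
rewrite -scalerAr -scalerDr -inbinE -mul_mpolyC; apply: MM; exact: inbin_max.
Qed.

Lemma max_toric f : maxI f -> exists g, toricI (f + 'X_i0 * g).
Proof.
move/maxI_span=> fE; have [M0 MD MM] := toricI_ideal.
exists (- \sum_(m <- msupp f) f@_m *: bin_corr m).
rewrite mulrN mulr_sumr {1}fE -sumrB; elim/big_ind: _ => // m _ /=.
rewrite -scalerAr -scalerBr inbinE addrK -mul_mpolyC; apply: MM; exact: bin_toric.
Qed.

Lemma initform_bin m : bin m != 0 -> initform (bin m) = inbin m.
Proof.
move=> nz; have [_ le lt] := repP m.
have ne_m : m != rep (wt m).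
  by apply: contraNneq nz => E; rewrite /bin -E subrr.
have supp m' : m' \in msupp (bin m) -> m' = m \/ m' = rep (wt m).
  rewrite mcoeff_msupp mcoeffB !mcoeffX; case: (m =P m') => [->|_]; first by left.
  by case: (_ =P m') => [->|_]; [right | rewrite subrr eqxx].
have supp_m : m \in msupp (bin m).
  rewrite mcoeff_msupp mcoeffB !mcoeffX eqxx [rep _ == m]eq_sym (negbTE ne_m).
  by rewrite subr0 oner_eq0.
have dE : mindeg (bin m) = mdeg m.
  by apply: (mindegE supp_m) => // m' /supp[]->.
rewrite /initform dE /inbin /is_max; apply/mpolyP => m'.
rewrite mcoeff_pihomog; case: ifPn => dm'; case: ifPn => mm //.
- rewrite mcoeffB !mcoeffX; case: (rep (wt m) =P m') => [E|_]; last by rewrite subr0.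
  by case/eqP: mm; rewrite E (eqP dm').
- apply/esym/eqP; rewrite mcoeff_eq0; apply: contraNN dm' => /supp[->|->] //.
  by rewrite eq_sym.
- by rewrite mcoeffX; case: (m =P m') dm' => [->|//]; rewrite eqxx.
Qed.

(** Compare coefficients at each weight [h]. If the maximal length of [h] is the least degree of
    [f], all monomials of [f] of weight [h] have that degree, and the coefficient is that of
    [monoid_map f], namely zero. Otherwise no monomial of weight [h] in the initial form is
    maximal. *)
Lemma initform_maxI f : toricI f -> f != 0 -> maxI (initform f).
Proof.
move=> If nz_f; apply/polyP => h; rewrite coef0.
transitivity (if mdeg (rep h) == mindeg f then (monoid_map f)`_h else 0); last first.
  by rewrite If coef0 if_same.
rewrite {1}/initform pihomogE raddf_sum /= monoid_mapE /mlin !coef_sum big_mkcond /=.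
case: ifPn => dh; last first.
  rewrite big1 // => m _; case: ifP => // dm; rewrite linearZ /= max_mapX coefZ.
  case: ifP => mm; rewrite ?coef0 ?mulr0 // coefXn.
  case: eqP => [E|]; rewrite ?mulr0 //; case/negP: dh.
  by rewrite E -(eqP mm) dm.
apply: eq_big_seq => m mf; rewrite coefZ coefXn.
case: (h =P wt m) => [hE|/eqP/negbTE ne_h]; last first.
  rewrite mulr0; case: ifP; rewrite ?coef0 // => _; rewrite linearZ /= max_mapX.
  by case: ifP; rewrite coefZ ?coef0 ?mulr0 // coefXn ne_h mulr0.
have mm : mdeg m = mindeg f.
  apply/eqP; rewrite eqn_leq mindeg_le // andbT -(eqP dh) hE.
  exact: leq_mdeg_rep.
rewrite mm eqxx linearZ /= max_mapX /is_max mm -hE eq_sym dh.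
by rewrite coefZ coefXn eqxx.
Qed.

Lemma initideal_toric f : initideal toricI f <-> maxI f.
Proof.
split; first by apply: ideal_gen_sub (maxI_ideal) _ f => _ [f [If nz ->]];
  apply: initform_maxI.
move/maxI_span=> ->; have [G0 GD GM] := ideal_gen_is_ideal
  (fun g => exists f0, [/\ toricI f0, f0 != 0 & g = initform f0]).
elim/big_ind: _ => // m _; rewrite -mul_mpolyC; apply: GM.
(* A zero binomial has no initial form, but then [m] is its own representative, hence maximal, and
   [inbin m] vanishes as well. *)
have [z|nz] := eqVneq (bin m) 0; last first.
  apply: ideal_gen_mem; exists (bin m); split=> //; first exact: bin_toric.
  by rewrite initform_bin.
rewrite /inbin; case: ifPn; rewrite ?z // => mm.
have mE : m = rep (wt m).
  have := congr1 (fun f => f@_m) z; rewrite mcoeffB !mcoeffX eqxx mcoeff0.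
  by case: eqP => // _ /eqP; rewrite subr0 oner_eq0.
by rewrite /is_max -mE eqxx in mm.
Qed.

Lemma toric_betti i : exists c, betti toricI i c /\ betti (initideal toricI) i c.
Proof.
have -> : initideal toricI = maxI.
  by apply/funext => f; apply/propext; apply: initideal_toric.
apply: (@betti_twin K s 'X_i0); last exact: max_toric; last exact: toric_max.
- by rewrite -msupp_eq0 msuppX.
- by rewrite mcoeffX mnm1_eq0.
- exact: toricI_ideal.
- exact: maxI_ideal.
- exact: toricI_saturated.
- exact: maxI_saturated.
Qed.

End Toric.

(** * Minimal generators *)

Section MinimalGenerators.
Variables (K : fieldType) (s : nat) (b : 'I_s -> nat) (i0 : 'I_s).
Variable rep : nat -> 'X_{1..s}.
Hypothesis b_pos : forall i, (0 < b i)%N.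
Hypothesis repP : is_rep b i0 rep.
Local Notation S := {mpoly K[s]}.
Local Notation wt := (wt b).
Local Notation bin := (bin K b rep).
Local Notation inbin := (inbin K b rep).
Local Notation toricI := (@toricI K s b).
Local Notation maxI := (@maxI K s b rep).
Implicit Types (f g : S) (m : 'X_{1..s}).

Lemma wt_eq0 m : wt m = 0%N -> m = 0%MM.
Proof.
move=> /eqP; rewrite /wt sum_nat_eq0 => /forallP w0; apply/mnmP => i.
by have := w0 i; rewrite implyTb muln_eq0 (gtn_eqF (b_pos i)) orbF mnm0E => /eqP.
Qed.

Lemma bin_homog m : bin m \is (wt m).-homog for wt.
Proof.
apply: rpredB; rewrite dhomogX ?eqxx //.
by apply/eqP; apply: wt_rep repP _.
Qed.

Lemma inbin_homog m : inbin m \is (wt m).-homog for wt.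
Proof.
by rewrite /inbin; case: ifP => _; [apply: bin_homog | rewrite dhomogX].
Qed.

Lemma pihomogM h h' f g : g \is h'.-homog for wt ->
  pihomog wt h (f * g) = (if (h' <= h)%N then pihomog wt (h - h') f else 0) * g.
Proof.
move=> g_hom; rewrite {1 2}[f]mpolyE mulr_suml raddf_sum /=.
transitivity (\sum_(m <- msupp f)
    (if (wt m + h' == h)%N then f@_m *: 'X_[m] else 0) * g).
  apply: eq_bigr => m _.
  have hom : f@_m *: 'X_[m] * g \is (wt m + h').-homog for wt.
    by apply: dhomogM => //; apply: rpredZ; rewrite dhomogX.
  by case: eqP => [<-|/eqP ne]; [apply: pihomog_dE | rewrite mul0r (pihomog_ne0 ne)].
rewrite -mulr_suml; congr (_ * _); case: leqP => [le|lt].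
  rewrite raddf_sum; apply: eq_bigr => m _ /=.
  rewrite linearZ /= pihomogX (_ : (_ == h - h')%N = (wt m + h' == h)%N).
    by case: ifP; rewrite ?scaler0.
  by rewrite -[in RHS](subnK le) eqn_add2r.
by rewrite big1 // => m _; case: eqP => // E; lia.
Qed.

Lemma pihomog0_weight f : pihomog wt 0 f = f@_0%MM *: 1.
Proof.
apply/mpolyP => m; rewrite mcoeff_pihomog mcoeffZ mcoeff1.
case: eqP => [/wt_eq0->|ne]; first by rewrite eqxx mulr1.
by case: eqP => [mE|]; rewrite ?mulr0 //; case: ne; rewrite mE; apply: wt0.
Qed.

Definition bin_gen (ms : seq 'X_{1..s}) : Prop := generates toricI (map bin ms).

(** By [toricI_span], the binomials of the monomials occurring in a finite generating set
    suffice. *)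
Lemma bin_gen_exists : exists ms, bin_gen ms.
Proof.
have [fs fsP] := mpoly_noetherian (toricI_ideal K b).
pose ms := flatten [seq msupp f : seq 'X_{1..s} | f <- fs]; exists ms => g.
have [G0 GD GM] := ideal_gen_is_ideal (fun h => h \in map bin ms); split.
  move/fsP; apply: ideal_gen_sub => // f ffs.
  have If : toricI f by apply/fsP; apply: ideal_gen_mem.
  rewrite (toricI_span rep If) big_seq_cond; elim/big_ind: _ => // m /andP[mf _].
  rewrite -mul_mpolyC; apply: (GM); apply: ideal_gen_mem; apply: map_f.
  by apply/flattenP; exists (msupp f) => //; apply: map_f.
apply: ideal_gen_sub; first exact: toricI_ideal.
by move=> _ /mapP[m _ ->]; apply: bin_toric repP _.
Qed.

(** Minimality is first taken among binomial generating sets; [min_bin_minimal] extends it to all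
    generating sets. *)
Lemma min_bin_gen_exists :
  exists2 ms, bin_gen ms & forall ms', bin_gen ms' -> (size ms <= size ms')%N.
Proof.
have ex : exists k, `[< exists2 ms, bin_gen ms & size ms = k >].
  by have [ms gms] := bin_gen_exists; exists (size ms); apply/asboolP; exists ms.
case: (ex_minnP ex) => k /asboolP[ms gms <-] mink; exists ms => // ms' gms'.
by apply: mink; apply/asboolP; exists ms'.
Qed.

Variable ms : seq 'X_{1..s}.
Hypothesis gen_ms : bin_gen ms.
Hypothesis min_ms : forall ms', bin_gen ms' -> (size ms <= size ms')%N.

Lemma bin_gen_sub ms' :
  (forall m, m \in ms -> ideal_gen (fun g => g \in map bin ms') (bin m)) ->
  bin_gen ms'.
Proof.
move=> sub g; split; last first.
  apply: ideal_gen_sub; first exact: toricI_ideal.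
  by move=> _ /mapP[m _ ->]; apply: bin_toric repP _.
move/gen_ms; apply: ideal_gen_sub; first exact: ideal_gen_is_ideal.
by move=> _ /mapP[m mms ->]; apply: sub.
Qed.

Lemma min_bin_gen_uniq : uniq ms.
Proof.
rewrite -[uniq ms]negbK -ltn_size_undup -leqNgt; apply: min_ms.
apply: bin_gen_sub => m mms; apply: ideal_gen_mem.
by apply: map_f; rewrite mem_undup.
Qed.

(* Graded Nakayama: a relation with a unit coefficient would make one of the
   generators redundant. *)
Lemma min_bin_relation (d : 'I_(size ms) -> S) :
  \sum_i d i * bin (nth 0%MM ms i) = 0 -> forall j, (d j)@_0%MM = 0.
Proof.
move=> rel j; apply/eqP; apply: contraT => nz; exfalso.
pose mj := nth 0%MM ms j; pose ms' := rem mj ms.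
have mj_ms : mj \in ms by apply: mem_nth.
have [G0 GD GM] := ideal_gen_is_ideal (fun g => g \in map bin ms').
have bin_ms' m : m \in ms -> m != mj ->
    ideal_gen (fun g => g \in map bin ms') (bin m).
  move=> mms ne; apply: ideal_gen_mem; apply: map_f.
  by rewrite mem_rem_uniq ?min_bin_gen_uniq // !inE ne.
have /min_ms : bin_gen ms'.
  apply: bin_gen_sub => m mms; have [->|ne] := eqVneq m mj; last exact: bin_ms'.
  (* In the weight of [mj], the coefficient of [bin mj] reduces to the nonzero constant term of
     [d j], so the relation can be solved for [bin mj]. *)
  have := congr1 (pihomog wt (wt mj)) rel; rewrite raddf0 raddf_sum (bigD1 j) //=.
  rewrite (pihomogM _ _ (bin_homog _)) leqnn subnn pihomog0_weight -scalerAl mul1r.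
  move/eqP; rewrite addr_eq0 => /eqP E.
  rewrite -[bin mj](scalerK nz) E -mul_mpolyC -mulN1r mulrA; apply: (GM).
  apply: (big_ind (ideal_gen (fun g => g \in map bin ms'))) => // i ne_ij.
  rewrite (pihomogM _ _ (bin_homog _)); apply: (GM).
  by apply: bin_ms'; rewrite ?mem_nth // nth_uniq ?min_bin_gen_uniq.
by rewrite size_rem //; case: (ms) mj_ms => //= ? ? _; rewrite ltnn.
Qed.

Lemma bin_neq0 m : m \in ms -> bin m != 0.
Proof.
move=> mms; apply/eqP => z; have lt : (index m ms < size ms)%N by rewrite index_mem.
pose j := Ordinal lt.
suff /min_bin_relation/(_ j)/eqP :
    \sum_(i < size ms) (i == j)%:R * bin (nth 0%MM ms i) = 0.
  by rewrite eqxx mcoeff1 eqxx oner_eq0.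
apply: big1 => i _; have [->|_] := eqVneq i j; last by rewrite mul0r.
by rewrite /= nth_index // z mulr0.
Qed.

(** Each family is written in terms of the other. By [min_bin_relation] the constant terms of the
    two transition matrices satisfy [A C = 1], which bounds the number of rows of [A] by its number
    of columns. *)
Lemma min_bin_minimal : minimally_generates toricI (map bin ms).
Proof.
split=> // gs gen_gs; rewrite size_map.
have bin_gs (i : 'I_(size ms)) : exists a : 'I_(size gs) -> S,
    bin (nth 0%MM ms i) = \sum_j a j * gs`_j.
  by apply/ideal_genP/gen_gs; apply: bin_toric repP _.
have gs_bin (j : 'I_(size gs)) : exists c : 'I_(size ms) -> S,
    gs`_j = \sum_i c i * bin (nth 0%MM ms i).
  have /gen_ms/ideal_genP : toricI gs`_j.
    by apply/gen_gs; apply: ideal_gen_mem; apply: mem_nth.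
  rewrite size_map => -[c ->]; exists c; apply: eq_bigr => i _.
  by rewrite (nth_map 0%MM).
have [a aE] := choice bin_gs; have [c cE] := choice gs_bin.
pose A := \matrix_(i, j) (a i j)@_0%MM; pose C := \matrix_(j, i) (c j i)@_0%MM.
apply: (@mulmx1_min _ _ _ A C); apply/matrixP => i k.
apply/eqP; rewrite -subr_eq0; apply/eqP.
suff /min_bin_relation/(_ k) : \sum_(k < size ms)
    (\sum_j a i j * c j k - (i == k)%:R) * bin (nth 0%MM ms k) = 0.
  rewrite mcoeffB raddf_sum mcoeffMn mcoeff1 eqxx => <-; rewrite !mxE.
  by congr (_ - _); apply: eq_bigr => j _; rewrite !mxE -rmorphM.
under eq_bigr do rewrite mulrBl mulr_suml.
rewrite sumrB exchange_big /=; apply/eqP; rewrite subr_eq0; apply/eqP.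
rewrite [RHS](bigD1 i) //= eqxx mul1r [X in _ = _ + X]big1; last first.
  by move=> k' /negbTE ne; rewrite eq_sym ne mul0r.
rewrite addr0 aE; apply: eq_bigr => j _; rewrite cE mulr_sumr.
by apply: eq_bigr => k' _; rewrite mulrA.
Qed.

(** Expressing [bin m] by the generators and passing to initial forms leaves an error ['X_i0 * D],
    with [D] in [maxI] by saturation. In the weight of [m], this error involves only [inbin m'] with
    [wt m' = wt m - b i0], which the induction covers. *)
Lemma inbin_gen m : ideal_gen (fun g => g \in map inbin ms) (inbin m).
Proof.
set G := ideal_gen _; have [G0 GD GM] : is_ideal G := ideal_gen_is_ideal _.
move: {2}(wt m) (erefl (wt m)) => h; elim/ltn_ind: h m => h IHh m mh.
have /gen_ms/ideal_genP[a aE] := bin_toric K repP m.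
pose mi (i : 'I_(size (map bin ms))) := nth 0%MM ms i.
have {}aE : bin m = \sum_i a i * bin (mi i).
  rewrite aE; apply: eq_bigr => i _; rewrite (nth_map 0%MM) //.
  by have := ltn_ord i; rewrite {2}size_map.
have Gmi i : G (inbin (mi i)).
  apply: ideal_gen_mem; apply: map_f; apply: mem_nth.
  by have := ltn_ord i; rewrite {2}size_map.
pose D := bin_corr K b i0 rep m - \sum_i a i * bin_corr K b i0 rep (mi i).
have inE : inbin m = \sum_i a i * inbin (mi i) + 'X_i0 * D.
  have -> : \sum_i a i * inbin (mi i) =
      \sum_i a i * bin (mi i) + 'X_i0 * \sum_i a i * bin_corr K b i0 rep (mi i).
    rewrite mulr_sumr -big_split; apply: eq_bigr => i _.
    by rewrite (inbinE K repP (mi i)) mulrDr mulrCA.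
  by rewrite (inbinE K repP m) aE /D mulrBr [X in _ = _ + X]addrC addrA addrK.
have [J0 JD JM] := @maxI_ideal K s b i0 rep repP.
have JD' : maxI D.
  apply: (@maxI_saturated K s b i0 rep repP).
  have -> : 'X_i0 * D = inbin m + (-1) * \sum_i a i * inbin (mi i).
    by rewrite inE; ring.
  apply: (JD); first exact: inbin_max repP m.
  by apply: (JM); elim/big_ind: _ => // i _; apply: (JM); exact: inbin_max repP _.
rewrite -[inbin m](@pihomog_dE _ _ wt h); last by rewrite -mh inbin_homog.
rewrite inE raddfD raddf_sum /=; apply: (GD).
  by elim/big_ind: _ => // i _; rewrite (pihomogM _ _ (inbin_homog _)); apply: (GM).
rewrite (maxI_span JD') mulr_sumr raddf_sum /=; elim/big_ind: _ => // m' _.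
rewrite -scalerAr linearZ /= -mul_mpolyC; apply: (GM).
rewrite (pihomogM _ _ (inbin_homog _)); case: leqP => [le|_]; last by rewrite mul0r.
rewrite pihomogX; case: eqP => [E|_]; last by rewrite mul0r.
have {E} : wt U_(i0)%MM = (h - wt m')%N := E; rewrite wtU => E.
by apply: (GM); apply: (IHh (wt m')) => //; have := b_pos i0; lia.
Qed.

Lemma min_bin_standard : standard_basis toricI (map bin ms).
Proof.
split.
- by move=> _ /mapP[m _ ->]; apply: bin_toric repP _.
- by apply/mapP => -[m /bin_neq0 nz z]; rewrite -z eqxx in nz.
have -> : [seq initform f | f <- map bin ms] = map inbin ms.
  rewrite -map_comp; apply/eq_in_map => m mms /=.
  by apply: initform_bin repP _ _; apply: bin_neq0.
move=> g; rewrite (initideal_toric repP); split; last first.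
  apply: (@ideal_gen_sub _ _ maxI); first exact: (maxI_ideal K repP).
  by move=> _ /mapP[m _ ->]; apply: inbin_max repP _.
move/maxI_span->.
have [G0 GD GM] := ideal_gen_is_ideal (fun g => g \in map inbin ms).
elim/big_ind: _ => // m _; rewrite -mul_mpolyC; apply: (GM); exact: inbin_gen.
Qed.

End MinimalGenerators.

Lemma toric_standard_basis (K : fieldType) s (b : 'I_s -> nat) (i0 : 'I_s) rep :
  (forall i, 0 < b i)%N -> is_rep b i0 rep ->
  exists fs, minimally_generates (@toricI K s b) fs /\
             standard_basis (@toricI K s b) fs.
Proof.
move=> b_pos repP; have [ms gms min_ms] := min_bin_gen_exists K repP.
exists (map (bin K b rep) ms); split.
  exact: (min_bin_minimal b_pos repP).
exact: (min_bin_standard b_pos repP).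
Qed.

(** * A criterion for Cohen-Macaulayness *)

Section Nilpotents.
Variable A : comNzRingType.
Implicit Types a b c d : A.

Definition nilpotent_elt a : Prop := exists n, a ^+ n = 0.

Lemma nilpotent_ideal : is_ideal nilpotent_elt.
Proof.
split; first by exists 1%N; rewrite expr1.
- move=> a b [n an] [m bm]; exists (n + m)%N; rewrite exprDn big1 // => i _.
  have [le|lt] := leqP m i.
    by rewrite -(subnK le) exprD bm !mulr0 mul0rn.
  have le : (n <= n + m - i)%N by lia.
  by rewrite -(subnK le) exprD an mulr0 mul0r mul0rn.
- by move=> a b [n bn]; exists n; rewrite exprMn bn mulr0.
Qed.

Lemma nilpotent_congrM a b c d : nilpotent_elt (a - c) -> nilpotent_elt (b - d) ->
  nilpotent_elt (a * b - c * d).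
Proof.
move=> nac nbd; have [_ ND NM] := nilpotent_ideal.
have -> : a * b - c * d = b * (a - c) + c * (b - d) by ring.
by apply: ND; apply: NM.
Qed.

Lemma nilpotent_congrX a c n :
  nilpotent_elt (a - c) -> nilpotent_elt (a ^+ n - c ^+ n).
Proof.
move=> nac; elim: n => [|n IHn]; first by rewrite subrr; case: nilpotent_ideal.
by rewrite !exprS; apply: nilpotent_congrM.
Qed.

Lemma prime_pow (P : A -> Prop) a n : prime_ideal P -> P (a ^+ n) -> P a.
Proof.
case=> _ P1 PM; elim: n => [/P1//|n IHn].
by rewrite exprS => /PM[|/IHn].
Qed.

Lemma prime_nilpotent (P : A -> Prop) a : prime_ideal P -> nilpotent_elt a -> P a.
Proof.
by move=> prP [n an]; apply: (@prime_pow P a n) => //; rewrite an; case: prP => -[].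
Qed.

Lemma prime_congr (P : A -> Prop) a b : prime_ideal P -> nilpotent_elt (a - b) ->
  P b -> P a.
Proof.
move=> prP /(prime_nilpotent prP) Pab Pb; rewrite -(subrK b a).
by have [[_ PD _] _ _] := prP; apply: PD.
Qed.

Lemma nilpotent_sym a b : nilpotent_elt (a - b) -> nilpotent_elt (b - a).
Proof.
have -> : b - a = -1 * (a - b) by ring.
by have [_ _ NM] := nilpotent_ideal; apply: NM.
Qed.

Lemma maximal_prime (P : A -> Prop) : maximal_ideal P -> prime_ideal P.
Proof.
case=> idP P1 maxP; have [P0 PD PM] := idP; split=> // a b Pab.
have [Pa|nPa] := pselect (P a); [by left | right].
pose J c := exists p r, P p /\ c = p + r * a.
have idJ : is_ideal J.
  split; first by exists 0, 0; rewrite mul0r addr0.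
  - move=> _ _ [p [r [Pp ->]]] [p' [r' [Pp' ->]]]; exists (p + p'), (r + r').
    by split; [apply: PD | ring].
  - move=> c _ [p [r [Pp ->]]]; exists (c * p), (c * r).
    by split; [apply: PM | ring].
have [[p [r [Pp E]]]|nJ1] := pselect (J 1).
  have -> : b = b * p + r * (a * b) by rewrite -[LHS]mulr1 E; ring.
  by apply: PD; apply: PM.
case: nPa; apply: (maxP J idJ nJ1).
  by move=> c Pc; exists c, 0; rewrite mul0r addr0.
by exists 0, 1; rewrite mul1r add0r.
Qed.

Lemma in_loc_pow (P J : A -> Prop) y n a :
  (forall a, in_loc_ideal P J (y * a) -> in_loc_ideal P J a) ->
  in_loc_ideal P J (y ^+ n * a) -> in_loc_ideal P J a.
Proof.
move=> reg; elim: n => [|n IHn]; first by rewrite mul1r.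
by rewrite exprS -mulrA => /reg/IHn.
Qed.

Lemma ideal_gen_nil a : ideal_gen (fun x => x \in [::]) a -> a = 0.
Proof. by move=> /ideal_genP[c ->]; rewrite big_ord0. Qed.

Lemma ideal_gen_seq1 y a : ideal_gen (fun x => x \in [:: y]) a <->
  exists c, a = c * y.
Proof.
rewrite ideal_genP; split=> [[c ->]|[c ->]]; first by exists (c ord0); rewrite big_ord1.
by exists (fun=> c); rewrite big_ord1.
Qed.

(** Covers the zero semigroup; dimension and depth are both 0. *)
Lemma cohen_macaulay_field :
  (forall a, a != 0 -> exists b, b * a = 1) -> cohen_macaulay A.
Proof.
move=> inv; split=> [J [J0 JD JM]|P [[P0 PD PM] P1 _]].
  have [[a Ja nz_a]|no] := pselect (exists2 a, J a & a != 0).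
    exists [:: 1] => b; rewrite ideal_gen_seq1; have [c ca] := inv a nz_a.
    split=> _; first by exists b; rewrite mulr1.
    by rewrite -[b]mulr1 -ca; apply: (JM); apply: (JM).
  exists [::] => b; split=> [Jb|/ideal_gen_nil->//].
  have [->|nz_b] := eqVneq b 0.
    by case: (ideal_gen_is_ideal (fun x : A => x \in [::])).
  by case: no; exists b.
have P_0 a : P a -> a = 0.
  move=> Pa; apply/eqP; apply: contraT => /inv[b ba]; case: P1.
  by rewrite -ba; apply: PM.
have idz : prime_ideal (fun a : A => a = 0).
  split=> [||a b ab0].
  - by split=> // [a b -> ->|a b ->]; rewrite ?addr0 ?mulr0.
  - by apply/eqP; apply: oner_neq0.
  - have [->|/inv[c ca]] := eqVneq a 0; [by left | right].
    by rewrite -[b]mul1r -ca -mulrA ab0 mulr0.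
exists 0%N; split.
- exists (fun=> fun a => a = 0); split=> // [a ->//].
- move=> [|e] // [p [pr inc top]]; have [_ [a p1a np0a]] := inc 0%N isT.
  have : p e.+1 a.
    suff H k : (1 <= k <= e.+1)%N -> p k a by apply: H; rewrite leqnn.
    elim: k => // -[|k] IHk // /andP[_ le].
    by have [sub _] := inc k.+1 le; apply: sub; apply: IHk; lia.
  move/top/P_0 => a0; case: np0a; rewrite a0.
  by have [[p00 _ _] _ _] := pr 0%N isT.
- exists [::] => //; split=> // x; rewrite in_nil //.
- move=> [|x xs] // [xsP reg]; have x0 : x = 0 by apply/P_0/xsP; rewrite mem_head.
  have [|t nPt /ideal_gen_nil] := reg 0%N isT 1.
    exists 1 => //; rewrite /= x0 mul0r mulr0.
    by case: (ideal_gen_is_ideal (fun x : A => x \in [::])).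
  by rewrite mulr1 => t0; case: nPt; rewrite t0.
Qed.

End Nilpotents.

(** * Rings that are an affine line modulo nilpotents *)

Section OneDimensional.
Variables (K : fieldType) (A : comNzRingType) (rho : {rmorphism {poly K} -> A}).
Hypothesis noethA : noetherian A.
Hypothesis rho_nil : forall a, exists p, nilpotent_elt (a - rho p).
Hypothesis rho_reg : forall p a, p != 0 -> rho p * a = 0 -> a = 0.

Lemma rho_nilpotent p : nilpotent_elt (rho p) -> p = 0.
Proof.
case=> n; rewrite -rmorphXn => E; apply/eqP; apply: contraT => nz.
have : rho (p ^+ n) * 1 = 0 by rewrite E mul0r.
by move/(rho_reg (expf_neq0 n nz))/eqP; rewrite oner_eq0.
Qed.

Lemma nilradical_prime : prime_ideal (@nilpotent_elt A).
Proof.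
have idN := nilpotent_ideal A; have [N0 ND NM] := idN; split=> //.
  by case=> n /eqP; rewrite expr1n oner_eq0.
move=> a b nab; have [p pa] := rho_nil a; have [q qb] := rho_nil b.
have : nilpotent_elt (rho (p * q)).
  rewrite rmorphM -(subrK (a * b) (_ * _)); apply: ND => //.
  by apply: nilpotent_sym; apply: nilpotent_congrM.
move/rho_nilpotent/eqP; rewrite mulf_eq0 => /orP[]/eqP z; [left|right].
  by move: pa; rewrite z rmorph0 subr0.
by move: qb; rewrite z rmorph0 subr0.
Qed.

Lemma poly_factor_power (q p : {poly K}) : (1 < size q)%N -> p != 0 ->
  exists m h, p = q ^+ m * h /\ ~~ (q %| h).
Proof.
move=> q1; have nz_q : q != 0 by rewrite -size_poly_gt0; lia.
move: {2}(size p) (leqnn (size p)) => n; elim: n p => [|n IHn] p.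
  by rewrite leqn0 size_poly_eq0 => ->.
move=> le_n nz_p; case: (boolP (q %| p)) => [|nq]; last first.
  by exists 0%N, p; rewrite expr0 mul1r.
case/dvdpP=> p' pE; have nz_p' : p' != 0.
  by apply: contraNneq nz_p => z; rewrite pE z mul0r.
have [||m [h [hE nqh]]] := IHn p' => //.
  move: le_n q1; rewrite pE size_mul //.
  move: (size p') (size q) => u v; lia.
by exists m.+1, h; rewrite pE hE exprS; split=> //; ring.
Qed.

Section AtMaximal.
Variable P : A -> Prop.
Hypothesis maxP : maximal_ideal P.

Let prP : prime_ideal P. Proof. exact: maximal_prime. Qed.

(** Otherwise [P] consists of nilpotents. The ideal [J] generated by the nilpotents and [rho 'X] is
    proper, as [1 - 'X * g] does not vanish at 0, so maximality puts [rho 'X] in [P]. *)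
Lemma rho_maximal_neq0 : exists2 q, q != 0 & P (rho q).
Proof.
have [//|no] := pselect (exists2 q, q != 0 & P (rho q)).
have Pnil a : P a -> nilpotent_elt a.
  move=> Pa; have [p pa] := rho_nil a.
  have [p0|nz] := eqVneq p 0; first by move: pa; rewrite p0 rmorph0 subr0.
  case: no; exists p => //; apply: prime_congr Pa => //; exact: nilpotent_sym.
have [N0 ND NM] := nilpotent_ideal A.
pose J a := exists c, nilpotent_elt (a - rho 'X * c).
have idJ : is_ideal J.
  split; first by exists 0; rewrite mulr0 subr0.
  - move=> a b [c nc] [d nd]; exists (c + d).
    rewrite (_ : _ - _ = a - rho 'X * c + (b - rho 'X * d)); last by ring.
    exact: ND.
  - move=> a b [c nc]; exists (a * c).
    rewrite (_ : _ - _ = a * (b - rho 'X * c)); last by ring.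
    exact: NM.
have nJ1 : ~ J 1.
  case=> c nc; have [g gc] := rho_nil c.
  have : nilpotent_elt (rho (1 - 'X * g)).
    rewrite rmorphB rmorphM rmorph1.
    rewrite (_ : _ - _ = (1 - rho 'X * c) + rho 'X * (c - rho g)); last by ring.
    by apply: ND => //; apply: NM.
  move/rho_nilpotent/(congr1 (fun p => p.[0]))/eqP.
  by rewrite !hornerE ?mul0r ?subr0 ?oppr0 ?addr0 oner_eq0.
have [_ _ /(_ J idJ nJ1) maxJ] := maxP.
case: no; exists 'X; first by rewrite polyX_eq0.
apply: maxJ; last by exists 1; rewrite mulr1 subrr.
by move=> a /Pnil na; exists 0; rewrite mulr0 subr0.
Qed.

Lemma rho_maximal_gen : exists q : {poly K},
  (1 < size q)%N /\ forall p, P (rho p) <-> q %| p.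
Proof.
have [[P0 PD PM] P1 _] := prP; have [q0 nz_q0 Pq0] := rho_maximal_neq0.
have ex : exists n, `[< exists q, [/\ q != 0, P (rho q) & size q = n] >].
  by exists (size q0); apply/asboolP; exists q0.
case: (ex_minnP ex) => n /asboolP[q [nz_q Pq <-]] minq.
have dvdP p : P (rho p) <-> q %| p.
  split=> [Pp|/dvdpP[c ->]]; last by rewrite rmorphM; apply: PM.
  apply/modp_eq0P/eqP; apply: contraT => nz.
  have : (size q <= size (p %% q)%R)%N.
    apply: minq; apply/asboolP; exists (p %% q); split=> //.
    have -> : p %% q = p - p %/ q * q by rewrite {2}(divp_eq p q) addrAC subrr add0r.
    rewrite rmorphB rmorphM -mulN1r; apply: (PD) => //; by apply: (PM); apply: (PM).
  by rewrite leqNgt ltn_modp nz_q.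
exists q; split=> //; rewrite ltn_neqAle size_poly_gt0 nz_q andbT.
apply/negP => /eqP/esym/eqP/size_poly1P[c nz_c qc]; apply: P1.
rewrite -(rmorph1 rho); apply/dvdP; rewrite qc.
by apply/dvdpP; exists (c^-1)%:P; rewrite -polyCM mulVf.
Qed.

(** The nilradical lies strictly below [P]. In a longer chain, [p 1] contains a non-nilpotent
    element, congruent to some [rho (q ^+ m * h)] with [rho h] outside [P]; hence [rho q] is in
    [p 1], which forces [p 1] to contain all of [P]. *)
Lemma maximal_loc_dim : loc_dim P 1.
Proof.
have [q [q1 qP]] := rho_maximal_gen; have nz_q : q != 0 by rewrite -size_poly_gt0; lia.
have Pq : P (rho q) by apply/qP.
split.
  exists (fun i => if i is 0%N then @nilpotent_elt A else P); split=> //.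
  - by move=> [|i] // _; apply: nilradical_prime.
  - move=> [|i] // _; split; first by move=> a; apply: prime_nilpotent.
    by exists (rho q) => // /rho_nilpotent/eqP; rewrite (negbTE nz_q).
move=> e [p [pr inc top]]; rewrite leqNgt; apply/negP => e2.
have [_ [a p1a np0a]] := inc 0%N (ltnW e2).
have [sub12 [a2 p2a np1a]] := inc 1%N e2.
have le_pe k b : (1 <= k <= e)%N -> p k b -> P b.
  move=> /andP[k1 ke] pkb; apply: top.
  suff H j : (k <= j <= e)%N -> p j b by apply: H; rewrite ke leqnn.
  elim: j => [|j IHj] /andP[kj je]; first lia.
  move: kj; rewrite leq_eqVlt => /orP[/eqP<-//|kj].
  have [sub _] := inc j je; apply: sub; apply: IHj; lia.
have pr1 := pr 1%N (ltnW e2).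
have [g ga] := rho_nil a.
have nz_g : g != 0.
  apply/eqP => g0; apply: np0a; apply: prime_nilpotent; first exact: (pr 0%N).
  by move: ga; rewrite g0 rmorph0 subr0.
have [m [h [gE nqh]]] := poly_factor_power q1 nz_g.
have p1q : p 1%N (rho q).
  have : p 1%N (rho g) by apply: prime_congr p1a => //; apply: nilpotent_sym.
  rewrite gE rmorphM rmorphXn; have [_ _ p1M] := pr1; case/p1M.
    exact: prime_pow.
  move/(le_pe 1%N); rewrite (ltnW e2) => /(_ isT)/qP; by rewrite (negbTE nqh).
apply: np1a; have Pa2 : P a2 by apply: (le_pe 2%N).
have [g2 ga2] := rho_nil a2; apply: (prime_congr pr1 ga2).
have /qP/dvdpP[c ->] : P (rho g2).
  by apply: prime_congr Pa2 => //; apply: nilpotent_sym.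
by rewrite rmorphM; have [[_ _ pM] _ _] := pr1; apply: pM.
Qed.

(** The element [rho q] is regular. For two elements [y1], [y2] of [P], congruent to
    [rho (q ^+ m * h)] and [rho (c * q)] modulo nilpotents, a power of [y2] becomes a multiple of
    [y1] in the localization, so [y2] is not regular modulo [y1]. *)
Lemma maximal_loc_depth : loc_depth P 1.
Proof.
have [q [q1 qP]] := rho_maximal_gen; have nz_q : q != 0 by rewrite -size_poly_gt0; lia.
have Pq : P (rho q) by apply/qP.
have [[P0 PD PM] P1 PP] := prP.
have [N0 ND NM] := nilpotent_ideal A.
split.
  exists [:: rho q] => //; split=> [x|[|//] _ J a]; first by rewrite inE => /eqP->.
  case=> t nPt /ideal_gen_nil E; exists t => //.
  rewrite (rho_reg (p := q) (a := t * a)) //; last by rewrite mulrCA.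
  by case: (ideal_gen_is_ideal (fun x : A => x \in take 0 [:: rho q])).
case=> [|y1 [|y2 xs]] // [xsP reg]; exfalso.
have reg1 := reg 0%N isT; have reg2 := reg 1%N isT; rewrite /= ?take0 in reg1 reg2.
have Py1 : P y1 by apply: xsP; rewrite !inE eqxx.
have Py2 : P y2 by apply: xsP; rewrite !inE eqxx orbT.
have [g1 g1y] := rho_nil y1; have [g2 g2y] := rho_nil y2.
have nz_g1 : g1 != 0.
  apply/eqP => g10; move: g1y; rewrite g10 rmorph0 subr0 => -[n y1n].
  have [|t nPt /ideal_gen_nil] := @in_loc_pow _ P _ y1 n 1 reg1.
    exists 1 => //; rewrite y1n mul0r mulr0.
    by case: (ideal_gen_is_ideal (fun x : A => x \in [::])).
  by rewrite mulr1 => t0; case: nPt; rewrite t0.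
have /qP/dvdpP[c g2E] : P (rho g2).
  by apply: prime_congr Py2 => //; apply: nilpotent_sym.
have [m [h [g1E nqh]]] := poly_factor_power q1 nz_g1.
have [N uN] : nilpotent_elt (rho h * y2 ^+ m - rho (c ^+ m) * y1).
  rewrite (_ : _ - _ = rho h * (y2 ^+ m - rho g2 ^+ m)
                       + (- rho (c ^+ m)) * (y1 - rho g1)); last first.
    by rewrite g1E g2E !rmorphM !rmorphXn exprMn; ring.
  by apply: (ND); apply: (NM) => //; apply: nilpotent_congrX.
have nPh : ~ P (rho h) by move/qP; rewrite (negbTE nqh).
have [|t nPt /ideal_gen_seq1[d]] := @in_loc_pow _ P _ y2 (m * N) 1 reg2.
  exists (rho h ^+ N); first by move/(prime_pow prP).
  apply/ideal_gen_seq1.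
  (* For the nilpotent difference [u = rho h * y2 ^+ m - rho (c ^+ m) * y1], the power
     [(rho h * y2 ^+ m) ^+ N] equals its difference with [u ^+ N = 0], which is a multiple of
     [rho (c ^+ m) * y1]. *)
  have := subrXX (rho h * y2 ^+ m) (rho h * y2 ^+ m - rho (c ^+ m) * y1) N.
  rewrite uN subr0 exprMn -exprM mulr1 => ->.
  by rewrite subKr mulrAC; eexists.
by rewrite mulr1 => tE; apply: nPt; rewrite tE; apply: PM.
Qed.

End AtMaximal.

Lemma cohen_macaulay_line : cohen_macaulay A.
Proof.
split=> // P maxP; exists 1%N; [exact: maximal_loc_dim | exact: maximal_loc_depth].
Qed.

End OneDimensional.

(** * The tangent cone *)

Lemma noetherian_surj (B A : comNzRingType) (phi : {rmorphism B -> A}) :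
  (forall a, exists b, a = phi b) -> noetherian B -> noetherian A.
Proof.
move=> surj noethB J [J0 JD JM].
have [|s sJ] := noethB (fun b => J (phi b)).
  split=> [|a b|a b]; rewrite ?rmorph0 ?rmorphD ?rmorphM //; [exact: JD|exact: JM].
exists (map phi s) => a.
have [G0 GD GM] := ideal_gen_is_ideal (fun x => x \in map phi s).
split; last first.
  apply: ideal_gen_sub => // _ /mapP[b bs ->].
  by apply/(sJ b); apply: ideal_gen_mem.
have [b ->] := surj a; move/(sJ b).
apply: (@ideal_gen_sub _ _ (fun b => ideal_gen (fun x => x \in map phi s) (phi b))).
  split=> [|u v|u v]; rewrite ?rmorph0 ?rmorphD ?rmorphM //; [exact: GD|exact: GM].
by move=> c cs; apply: ideal_gen_mem; apply: map_f.
Qed.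

(** * Cohen-Macaulayness of the quotient by the initial ideal *)

Section InitialQuotient.
Variables (K : fieldType) (s : nat) (b : 'I_s -> nat) (i0 : 'I_s).
Variable rep : nat -> 'X_{1..s}.
Hypothesis b_pos : forall i, (0 < b i)%N.
Hypothesis b_min : forall i, i != i0 -> (b i0 < b i)%N.
Hypothesis repP : is_rep b i0 rep.
Local Notation S := {mpoly K[s]}.
Variables (A : comNzRingType) (Phi : {rmorphism S -> A}).
Hypothesis Phi_surj : forall a, exists f, a = Phi f.
Hypothesis Phi_ker : forall f, Phi f = 0 <-> maxI b rep f.

Lemma Phi_nilpotent i : i != i0 -> nilpotent_elt (Phi 'X_i).
Proof.
move=> ne; exists (b i0); rewrite -rmorphXn; apply/Phi_ker.
rewrite /maxI mpolyXn max_mapX; case: ifP => //.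
have w : wt b (U_(i0) *+ b i)%MM = wt b (U_(i) *+ b i0)%MM.
  by rewrite !wtMn !wtU mulnC.
have := leq_mdeg_rep repP w; rewrite !mdegMn !mdeg1 !mul1n => le.
rewrite /is_max mdegMn mdeg1 mul1n => /eqP E; have := b_min ne; lia.
Qed.

Let rho : {rmorphism {poly K} -> A} := Phi \o horner_alg ('X_i0 : S).

Lemma rho_dense a : exists p, nilpotent_elt (a - rho p).
Proof.
have [N0 ND NM] := nilpotent_ideal A; have [f ->] := Phi_surj a.
rewrite [f]mpolyE; elim/big_ind: _ => [|u v [p pu] [q qv]|m _].
- by exists 0; rewrite !rmorph0 subr0.
- exists (p + q); rewrite !rmorphD.
  rewrite (_ : _ - _ = (Phi u - rho p) + (Phi v - rho q)); last by rewrite opprD addrACA.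
  exact: ND.
rewrite -mul_mpolyC; case: (pselect (exists2 i, i != i0 & m i != 0%N)) => [[i ne mi]|no].
  exists 0; rewrite rmorph0 subr0 rmorphM; apply: (NM).
  rewrite -(submK (m := U_(i)) (m' := m)) ?lep1mP // mpolyXD rmorphM; apply: (NM).
  exact: Phi_nilpotent.
exists ((f@_m)%:P * 'X^(m i0)); rewrite (_ : _ - _ = 0) //; apply/eqP.
rewrite subr_eq0; apply/eqP; congr (Phi _).
rewrite [RHS]rmorphM [X in _ = _ * X]rmorphXn /= horner_algC horner_algX.
rewrite alg_mpolyC mpolyXn; congr (_ * 'X_[_]); apply/mnmP => i.
rewrite mulmnE mnm1E; case: (i0 =P i) => [->|/eqP ne]; first by rewrite mul1n.
rewrite mul0n; apply/eqP; apply/negP => /negP mi; apply: no.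
by exists i; rewrite // eq_sym.
Qed.

(** Multiplication by the variable [i0] acts through [max_map] as multiplication by ['X^(b i0)];
    regularity of nonzero [p] thus reduces to [{poly K}] being a domain. *)
Lemma max_map_horner p f :
  max_map b rep (horner_alg ('X_i0 : S) p * f) = (p \Po 'X^(b i0)) * max_map b rep f.
Proof.
elim/poly_ind: p f => [|p c IHp] f.
  by rewrite comp_poly0 rmorph0 !mul0r raddf0.
rewrite rmorphD rmorphM /= horner_algX horner_algC alg_mpolyC comp_polyD comp_polyM.
rewrite comp_polyX comp_polyC !mulrDl raddfD /= -mulrA IHp mul_mpolyC linearZ /=.
by rewrite (max_map_shift repP) mul_polyC mulrA.
Qed.

Lemma rho_regular p a : p != 0 -> rho p * a = 0 -> a = 0.
Proof.
move=> nz_p; have [f ->] := Phi_surj a.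
have -> : rho p * Phi f = Phi (horner_alg ('X_i0 : S) p * f) by rewrite rmorphM.
move/Phi_ker; rewrite /maxI max_map_horner => /eqP; rewrite mulf_eq0 comp_poly_eq0.
  by rewrite (negbTE nz_p) => /eqP/Phi_ker.
by rewrite size_polyXn ltnS.
Qed.

Lemma initial_quotient_cm : cohen_macaulay A.
Proof.
apply: (cohen_macaulay_line (rho := rho)); last exact: rho_regular.
  exact: noetherian_surj Phi_surj (@mpoly_noetherian K s).
exact: rho_dense.
Qed.

End InitialQuotient.

(** * The projection from the Rees algebra to the associated graded ring *)

Section GradedProjection.
Local Open Scope quotient_scope.
Variables (A : comNzRingType) (m : properIdeal A).

Definition gr_proj : rees m -> assoc_graded m :=
  \pi_{ideal_quot (@rees_ideal A m : idealr (rees m))}.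

HB.instance Definition _ := GRing.RMorphism.copy gr_proj
  \pi_{ideal_quot (@rees_ideal A m : idealr (rees m))}.

Lemma gr_proj_surj a : exists x, a = gr_proj x.
Proof. by exists (repr a); rewrite /gr_proj reprK. Qed.

Lemma gr_proj_eq0 x : gr_proj x = 0 <-> forall i, ideal_pow m i.+1 (rees_val x)`_i.
Proof.
rewrite -(rmorph0 gr_proj) /gr_proj; split.
  by move/eqP; rewrite -Quotient.idealrBE subr0 => /asboolP.
by move=> xP; apply/eqP; rewrite -Quotient.idealrBE subr0; apply/asboolP.
Qed.

Lemma ideal_pow_antimono i j x : (i <= j)%N -> ideal_pow m j x -> ideal_pow m i x.
Proof.
move=> /subnK <-; elim: (j - i)%N x => // k IHk x.
have [P0 PD PM] := ideal_pow_is_ideal m i.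
rewrite addSn /=; apply: ideal_gen_sub => // _ [a [c [_ /IHk mc ->]]].
exact: PM.
Qed.

End GradedProjection.

(** * Presentation of the tangent cone as a quotient of the polynomial ring *)

Section TangentCone.
Variables (K : fieldType) (L : numSemigroup).
Local Notation bs := (mingens L).
Local Notation s := (size bs).
Local Notation b := (fun i : 'I_s => nth 0%N bs i).
Local Notation S := {mpoly K[s]}.
Local Notation m := (sgring_max K L).
Implicit Types (f g : S).

Lemma sg_of_subproof f : toric_map f \in @sgring_pred K L.
Proof. by apply/asboolP; exists f. Qed.

Definition sg_of f : sgring K L := SgRing (sg_of_subproof f).

Lemma sg_of_is_zmod_morphism : zmod_morphism sg_of.
Proof. by move=> f g; apply: val_inj; rewrite /= /toric_map rmorphB. Qed.

Lemma sg_of_is_monoid_morphism : monoid_morphism sg_of.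
Proof.
by split=> [|f g]; apply: val_inj; rewrite /= /toric_map ?rmorph1 ?rmorphM.
Qed.

HB.instance Definition _ :=
  GRing.isZmodMorphism.Build S (sgring K L) sg_of sg_of_is_zmod_morphism.
HB.instance Definition _ :=
  GRing.isMonoidMorphism.Build S (sgring K L) sg_of sg_of_is_monoid_morphism.

Lemma sg_ofE f : sgring_val (sg_of f) = monoid_map b f.
Proof. by []. Qed.

Lemma sg_of_surj (x : sgring K L) : exists f, x = sg_of f.
Proof.
by case: x => p pP; have /asboolP[f fE] := pP; exists f; apply: val_inj.
Qed.

Definition order_ge i f : Prop := forall n, n \in msupp f -> (i <= mdeg n)%N.

Lemma sg_max_monomial (n : 'X_{1..s}) : ideal_pow m (mdeg n) (sg_of 'X_[n]).
Proof.
move: {2}(mdeg n) (erefl (mdeg n)) => d; elim: d n => [|d IHd] n dn.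
  by rewrite dn.
have /existsP[i ni] : [exists i, n i != 0%N].
  rewrite -negb_forall; apply/negP => /forallP n0; move: dn.
  by rewrite mdegE big1 // => i _; apply/eqP; rewrite -[_ == _]negbK n0.
have leU : (U_(i) <= n)%MM by rewrite lep1mP.
have dU : mdeg (n - U_(i))%MM = d by rewrite mdeg_sub // dn mdeg1 subn1.
rewrite dn -(submK leU) addmC mpolyXD rmorphM /=.
apply: ideal_gen_mem; exists (sg_of 'X_i), (sg_of 'X_[n - U_(i)]); split=> //.
  apply: ideal_gen_mem; exists (b i); first exact: mem_nth.
  by rewrite sg_ofE monoid_mapX wtU.
by have := IHd _ dU; rewrite dU.
Qed.

Lemma sg_max_powP i x : ideal_pow m i x <-> exists2 f, x = sg_of f & order_ge i f.
Proof.
split; last first.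
  have [P0 PD PM] := ideal_pow_is_ideal m i.
  case=> f -> ord_f; rewrite [f]mpolyE raddf_sum big_seq /=.
  elim/big_ind: _ => // n nf; rewrite -mul_mpolyC rmorphM; apply: PM.
  by apply: ideal_pow_antimono (ord_f n nf) _; apply: sg_max_monomial.
have ordP j : is_ideal (fun x => exists2 f, x = sg_of f & order_ge j f).
  split; first by exists 0; rewrite ?raddf0 // => n; rewrite msupp0.
  - move=> _ _ [f -> fP] [g -> gP]; exists (f + g); first by rewrite raddfD.
    by move=> n /msuppD_le; rewrite mem_cat => /orP[/fP|/gP].
  - move=> y _ [f -> fP]; have [g ->] := sg_of_surj y; exists (g * f).
      by rewrite rmorphM.
    move=> n /msuppM_le/allpairsP[[n1 n2] /= [_ /fP le ->]].
    by rewrite mdegD; apply: leq_trans le (leq_addl _ _).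
elim: i x => [|i IHi] x; first by have [f ->] := sg_of_surj x; exists f.
apply: (ideal_gen_sub (ordP i.+1)) => _ [y [z [my /IHi[g -> gP] ->]]].
have [f -> fP] : exists2 f, y = sg_of f & order_ge 1 f.
  apply: (ideal_gen_sub (ordP 1%N) _ my) => x1 [c cb xE].
  have lt : (index c bs < s)%N by rewrite index_mem.
  exists 'X_(Ordinal lt); last by move=> n; rewrite msuppX inE => /eqP->; rewrite mdeg1.
  by apply: val_inj; rewrite [RHS]sg_ofE monoid_mapX wtU /= nth_index.
exists (f * g); first by rewrite rmorphM.
move=> n /msuppM_le/allpairsP[[n1 n2] /= [/fP le1 /gP le2 ->]].
by rewrite mdegD -add1n leq_add.
Qed.

Definition rees_coef (c : K) : {poly sgring K L} := (sg_of c%:MP)%:P.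

HB.instance Definition _ := GRing.RMorphism.copy rees_coef
  (polyC \o (sg_of \o @mpolyC s K)).

(** Placing each variable in degree one of the Rees algebra keeps the homogeneous components of [f]
    apart. *)
Definition rees_poly f : {poly sgring K L} :=
  mmap rees_coef (fun i => (sg_of 'X_i)%:P * 'X) f.

HB.instance Definition _ := GRing.RMorphism.copy rees_poly
  (mmap rees_coef (fun i => (sg_of 'X_i)%:P * 'X)).

Lemma rees_polyX (n : 'X_{1..s}) : rees_poly 'X_[n] = (sg_of 'X_[n])%:P * 'X^(mdeg n).
Proof.
rewrite /rees_poly mmapX /mmap1.
rewrite (eq_bigr (fun i => (sg_of ('X_i ^+ n i))%:P * 'X^(n i))); last first.
  by move=> i _; rewrite exprMn -!rmorphXn.
rewrite big_split /= mpolyXE_id -!rmorph_prod mdegE; congr (_ * _).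
by rewrite (big_morph (fun k => 'X^k) (exprD _) (expr0 _)).
Qed.

Lemma rees_polyZ c f : rees_poly (c *: f) = rees_coef c * rees_poly f.
Proof. exact: mmapZ. Qed.

Lemma coef_rees_poly f i : (rees_poly f)`_i = sg_of (pihomog mdeg i f).
Proof.
rewrite {1}[f]mpolyE pihomogE !raddf_sum coef_sum /= [RHS]big_mkcond /=.
apply: eq_bigr => n _; rewrite rees_polyZ rees_polyX coefCM coefCM coefXn.
rewrite eq_sym; case: eqP => _; last by rewrite !mulr0.
by rewrite mulr1 -rmorphM mul_mpolyC.
Qed.

Lemma order_ge_pihomog i f : order_ge i (pihomog mdeg i f).
Proof. by move=> n /(dhomogP _ _ _ (pihomogP mdeg i f)) ->. Qed.

Lemma rees_poly_subproof f : rees_poly f \in rees_pred m.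
Proof.
apply/asboolP => i; rewrite coef_rees_poly; apply/sg_max_powP.
by exists (pihomog mdeg i f) => //; apply: order_ge_pihomog.
Qed.

Definition rees_of f : rees m := Rees (rees_poly_subproof f).

Definition cone_map f : tangent_cone K L := gr_proj (rees_of f).

Lemma cone_map_is_zmod_morphism : zmod_morphism cone_map.
Proof.
move=> f g; rewrite /cone_map -rmorphB; congr gr_proj.
by apply: val_inj; rewrite /= rmorphB.
Qed.

Lemma cone_map_is_monoid_morphism : monoid_morphism cone_map.
Proof.
split=> [|f g]; rewrite /cone_map.
  by rewrite -(rmorph1 (@gr_proj _ m)); congr gr_proj; apply: val_inj; rewrite /= rmorph1.
by rewrite -rmorphM; congr gr_proj; apply: val_inj; rewrite /= rmorphM.
Qed.

HB.instance Definition _ :=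
  GRing.isZmodMorphism.Build S (tangent_cone K L) cone_map cone_map_is_zmod_morphism.
HB.instance Definition _ :=
  GRing.isMonoidMorphism.Build S (tangent_cone K L) cone_map
    cone_map_is_monoid_morphism.

(** Coefficient [i] of a Rees element lifts to a polynomial of order at least [i]. Keeping only its
    part of degree [i] discards terms of higher order, which vanish in the graded ring. *)
Lemma cone_map_surj a : exists f, a = cone_map f.
Proof.
have [x ->] := gr_proj_surj a; have /asboolP xP := rees_valP x.
have /choice[F FP] i : exists f, (rees_val x)`_i = sg_of f /\ order_ge i f.
  by have /sg_max_powP[f] := xP i; exists f.
pose f := \sum_(i < size (rees_val x)) pihomog mdeg i (F i).
exists f; apply/eqP; rewrite -subr_eq0 /cone_map -rmorphB; apply/eqP.
apply/gr_proj_eq0 => i; rewrite /= coefB coef_rees_poly.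
have -> : pihomog mdeg i f =
    if (i < size (rees_val x))%N then pihomog mdeg i (F i) else 0.
  rewrite raddf_sum /=; case: ifPn => [lt|nlt].
    rewrite (bigD1 (Ordinal lt)) //= pihomog_id big1 ?addr0 // => j ne.
    by apply: pihomog_ne0 (pihomogP _ _ _); rewrite -val_eqE in ne.
  rewrite big1 // => j _; apply: pihomog_ne0 (pihomogP _ _ _).
  by apply: contraNneq nlt => <-.
case: ltnP => [_|le]; last first.
  rewrite nth_default // raddf0 subr0.
  by have [] := ideal_pow_is_ideal m i.+1.
have [-> ordF] := FP i; rewrite -(rmorphB sg_of).
apply: (sg_max_powP i.+1 _).2; exists (F i - pihomog mdeg i (F i)) => // n.
rewrite mcoeff_msupp mcoeffB mcoeff_pihomog.
case: (_ =P i) => [_|/eqP ne]; first by rewrite subrr eqxx.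
by rewrite subr0 -mcoeff_msupp => /ordF le; rewrite ltn_neqAle eq_sym ne.
Qed.

Variables (i0 : 'I_s) (rep : nat -> 'X_{1..s}).
Hypothesis repP : is_rep b i0 rep.

Lemma max_map_coef f h :
  (max_map b rep f)`_h = (monoid_map b (pihomog mdeg (mdeg (rep h)) f))`_h.
Proof.
rewrite max_mapE pihomogE raddf_sum /= !coef_sum [RHS]big_mkcond /=.
apply: eq_bigr => n _; rewrite monoid_mapE linearZ /= mlinX !coefZ.
rewrite /is_max; case: (h =P wt b n) => [->|ne].
  by case: eqP; rewrite ?coef0 ?mulr0.
have E : ('X^(wt b n) : {poly K})`_h = 0 by rewrite coefXn; case: eqP.
by case: ifP; case: ifP; rewrite ?coefZ ?E ?coef0 ?mulr0.
Qed.

(** A non-maximal monomial equals a longer one in [K[L]], so it lies in the next power of the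
    maximal ideal. Conversely, if the component of degree [d = mdeg (rep h)] maps into power
    [d + 1], its coefficient at [h] vanishes, since [h] has no factorization longer than [d]. *)
Lemma cone_map_ker f : cone_map f = 0 <-> maxI b rep f.
Proof.
split; last first.
  move/maxI_span->; rewrite raddf_sum big1 // => n _ /=.
  rewrite -mul_mpolyC rmorphM /=.
  suff -> : cone_map (inbin K b rep n) = 0 by rewrite mulr0.
  apply/gr_proj_eq0 => i; change (ideal_pow m i.+1 (rees_poly (inbin K b rep n))`_i).
  rewrite coef_rees_poly /inbin.
  have [P0 PD PM] := ideal_pow_is_ideal m i.+1.
  have E : sg_of 'X_[n] = sg_of 'X_[rep (wt b n)].
    by apply: val_inj; rewrite [LHS]sg_ofE [RHS]sg_ofE !monoid_mapX (wt_rep repP).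
  case: ifPn => mn.
    have hom : bin K b rep n \is (mdeg n).-homog for mdeg.
      by apply: rpredB; rewrite dhomogX //= eq_sym.
    have [di|ne] := eqVneq (mdeg n) i; last by rewrite (pihomog_ne0 ne) // raddf0.
    by rewrite -di (pihomog_dE hom) raddfB /= E subrr di.
  rewrite pihomogX; case: eqP => [<-|_]; last by rewrite raddf0.
  rewrite E; apply: ideal_pow_antimono (sg_max_monomial _).
  by rewrite ltn_neqAle mn; apply: (leq_mdeg_rep repP).
move/gr_proj_eq0 => fP; apply/polyP => h; rewrite coef0 max_map_coef.
have [g gE gP] := (sg_max_powP _ _).1 (fP (mdeg (rep h))).
move: gE; rewrite [LHS]coef_rees_poly => /(congr1 (@sgring_val _ _)).
rewrite !sg_ofE => ->; rewrite monoid_mapE /mlin coef_sum big_seq big1 // => n ng.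
rewrite coefZ coefXn; case: eqP => [hE|]; last by rewrite mulr0.
have := gP n ng; rewrite hE; have := leq_mdeg_rep repP (erefl (wt b n)).
lia.
Qed.

End TangentCone.

Lemma tangent_cone_field (K : fieldType) (L : numSemigroup) :
  size (mingens L) = 0%N -> cohen_macaulay (tangent_cone K L).
Proof.
move=> s0; apply: cohen_macaulay_field => a.
have [f ->] := cone_map_surj a; rewrite (nvar0_mpolyC_eq f s0) => nz.
have nz_c : f@_0%MM != 0.
  by apply: contraNneq nz => ->; rewrite mpolyC0 rmorph0.
exists (cone_map (f@_0%MM)^-1%:MP).
by rewrite -rmorphM -mpolyCM mulVf // mpolyC1 rmorph1.
Qed.

(** * Shifted semigroups *)

Section ZeroIdeal.
Variables (K : fieldType) (n : nat) (I : {mpoly K[n]} -> Prop).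
Hypothesis I0 : forall f, I f <-> f = 0.

Lemma initideal_zero f : initideal I f <-> f = 0.
Proof.
split=> [|->]; last by case: (ideal_gen_is_ideal
  (fun g => exists f0, [/\ I f0, f0 != 0 & g = initform f0])).
apply: (@ideal_gen_sub _ _ (fun f => f = 0)) => [|_ [g [/I0-> /eqP//]]].
by split=> // [a b -> ->|a b ->]; rewrite ?addr0 ?mulr0.
Qed.

Lemma zero_ideal_gen f : ideal_gen (fun h => h \in [::]) f <-> f = 0 :> {mpoly K[n]}.
Proof.
split=> [/ideal_gen_nil//|->].
by case: (ideal_gen_is_ideal (fun h : {mpoly K[n]} => h \in [::])).
Qed.

Lemma zero_standard_basis : minimally_generates I [::] /\ standard_basis I [::].
Proof.
split; first by split=> // g; rewrite I0 zero_ideal_gen.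
by split=> // g; rewrite initideal_zero zero_ideal_gen.
Qed.

Lemma zero_betti i : betti I i 0.
Proof.
have ex0 : exact_at (0 : 'M[{mpoly K[n]}]_(0, 0)) (0 : 'M_(0, 0)).
  by move=> v; split=> _; [exists 0|]; rewrite !thinmx0.
have exA : exact_at (0 : 'M[{mpoly K[n]}]_(0, 0)) (0 : 'M_(0, 1)).
  by move=> v; split=> _; [exists 0; rewrite !thinmx0 | rewrite mulmx0].
have aug f : I f <-> exists u : 'rV_0, u *m (0 : 'M_(0, 1)) = f%:M.
  rewrite I0; split=> [->|[u]]; first by exists 0; rewrite mulmx0 raddf0.
  rewrite mulmx0 => /matrixP/(_ 0 0); rewrite !mxE eqxx mulr1n => /esym//.
exists (@FreeResolution K n I (fun=> 0%N) 0 (fun=> 0) aug exA (fun=> ex0)).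
case: i => [|i]; rewrite /tor_dim /= ?sub0n //; apply/eqP.
by rewrite -leqn0 (leq_trans (leq_subr _ _)) // rank_leq_row.
Qed.

End ZeroIdeal.

Section ShiftedGenerators.

Lemma spanned_filter c B x : spanned B x -> (x < c)%N ->
  spanned [seq y <- B | y != c] x.
Proof.
move=> /asboolP[d ->] lt; set B' := filter _ _.
have term (i : 'I_(size B)) : spanned B' (d i * nth 0 B i)%N.
  have [E|ne] := eqVneq (nth 0%N B i) c; last first.
    apply: (@sgM (span_sg B')); apply: spanned_mem.
    by rewrite mem_filter ne mem_nth.
  suff -> : d i = 0%N by rewrite mul0n; apply: spanned0.
  move: lt; rewrite (bigD1 i) //= E; case: (d i) => // k; rewrite mulSn; lia.
elim/big_ind: _ => //; [exact: spanned0 | exact: spannedD].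
Qed.

(** The shifted generators span [L] but need not be minimal. A minimal generator is a nonempty sum
    of them, hence at least [k]; one exceeding all of them could be dropped by [spanned_filter]. *)
Lemma shift_mingens_bounds H k c : c \in mingens (shift_sg H k) ->
  (k <= c <= \max_(a <- mingens H) a + k)%N.
Proof.
set L := shift_sg H k; set M := (\max_(a <- mingens H) a)%N => cB.
have [sB posB LB minB] := mingensP L.
have Lc : L c by rewrite LB; apply: spanned_mem.
have c_gt0 : (0 < c)%N by move/allP: posB; apply.
apply/andP; split.
  move: Lc c_gt0 => /asboolP[d ->]; rewrite lt0n sum_nat_eq0 negb_forall.
  case/existsP=> i; rewrite implyTb muln_eq0 negb_or => /andP[di _].
  rewrite (bigD1 i) //= (leq_trans _ (leq_addr _ _)) //.
  have lti : (i < size (mingens H))%N by have := ltn_ord i; rewrite {2}size_map.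
  rewrite (nth_map 0%N) //; move: di; case: (d i) => // j _; rewrite mulSn; lia.
rewrite leqNgt; apply/negP => lt_c.
pose B' := [seq y <- mingens L | y != c].
have L_B' x : L x -> spanned B' x.
  apply: (@spanned_sub (span_sg B')) => y /mapP[a aH ->]; rewrite inE.
  have Ly : L (a + k)%N by apply: spanned_mem; apply: map_f.
  apply: spanned_filter; first by rewrite LB in Ly.
  by apply: leq_ltn_trans lt_c; rewrite leq_add2r; apply: leq_bigmax_seq.
have /minB E : L =1 span_sg B'.
  move=> x; apply/idP/idP => [/L_B'//|]; rewrite LB.
  apply: (@spanned_sub (span_sg (mingens L))) => y.
  by rewrite mem_filter => /andP[_ yB]; rewrite inE; apply: spanned_mem.
have : c \in B' by rewrite E ?filter_subseq.
by rewrite mem_filter eqxx.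
Qed.

End ShiftedGenerators.

Theorem theorem1p4 (K : fieldType) (H : numSemigroup) :
  exists k0 : nat, forall k : nat, (k0 <= k)%N ->
    let L := shift_sg H k in
    let I := toric_ideal (K := K) (L := L) in
    [/\ exists fs, minimally_generates I fs /\ standard_basis I fs,
        forall i : nat, exists c : nat, betti I i c /\ betti (initideal I) i c
      & cohen_macaulay (tangent_cone K L)].
Proof.
(* The minimal generators of [L] lie between [k] and [M + k], so their spread is at most [M], and
   [k >= M ^ 2] yields [b_gap]. *)
pose M := (\max_(a <- mingens H) a)%N; exists (M ^ 2)%N => k le_k L I.
(* Without generators [L] is zero, and there is no smallest generator [i0] to work with; the toric
   ideal is then zero. *)
have [s0|s_gt0] := posnP (size (mingens L)).
  have I0 f : I f <-> f = 0.
    rewrite /I /toric_ideal; split=> [|->]; last by rewrite /toric_map rmorph0.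
    rewrite (nvar0_mpolyC_eq f s0) /toric_map mmapC => /eqP.
    by rewrite polyC_eq0 => /eqP->; rewrite mpolyC0.
  split; first by exists [::]; apply: zero_standard_basis.
  - move=> i; exists 0%N; split; apply: zero_betti => // f.
    exact: initideal_zero.
  - exact: tangent_cone_field.
pose b (i : 'I_(size (mingens L))) := nth 0%N (mingens L) i.
have [sB /allP posB _ _] := mingensP L.
have lt_pred : ((size (mingens L)).-1 < size (mingens L))%N by rewrite prednK.
pose i0 := Ordinal s_gt0; pose il := Ordinal lt_pred.
have b_lt (i j : 'I_(size (mingens L))) : (i < j)%N -> (b i < b j)%N.
  by move=> lt; apply: (sorted_ltn_nth ltn_trans) => //; apply: ltn_ord.
have b_pos i : (0 < b i)%N by apply: posB; apply: mem_nth.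
have b_min i : i != i0 -> (b i0 < b i)%N.
  by move=> ne; apply: b_lt; rewrite lt0n.
have b_le i : (b i0 <= b i)%N.
  by have [->//|/b_min/ltnW] := eqVneq i i0.
have b_max i : i != il -> (b i < b il)%N.
  move=> ne; apply: b_lt; rewrite ltn_neqAle -val_eqE in ne *.
  by rewrite ne /= -ltnS prednK.
have b_gap : ((b il - b i0) ^ 2 <= b i0)%N.
  have bd i : (k <= b i <= M + k)%N.
    exact: shift_mingens_bounds (mem_nth 0%N (ltn_ord i)).
  have /andP[le_k0 _] := bd i0; have /andP[_ le_M] := bd il.
  apply: leq_trans le_k0; apply: leq_trans le_k; rewrite leq_exp2r // leq_subLR.
  by rewrite (leq_trans le_M) // addnC leq_add2r; have /andP[] := bd i0.
have [rep repP] := rep_exists (b_pos i0) b_le b_max b_gap.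
split.
- exact: (toric_standard_basis K b_pos repP).
- exact: (toric_betti K repP).
- apply: (initial_quotient_cm b_pos b_min repP (Phi := @cone_map K L)).
    exact: cone_map_surj.
  exact: (cone_map_ker (K := K) repP).
Qed.
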